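(* Consider the problem $$\min_{x\in\mathbb{R}^{d_x}}\max_{y\in\mathbb{R}^{d_y}}\{f(x)+G(x,y)-h(y)\},\qquad G(x,y)=\frac1{m_G}\sum_{i=1}^{m_G}G_i(x,y),$$ with $m_G\ge1$, where $f$ is $\mu_x$-strongly convex and $L_f$-smooth, $h$ is $\mu_y$-strongly convex, $L_h$-smooth and prox-friendly, each $G_i$ is convex in $x$, concave in $y$ and $L_G^i$-smooth jointly in $(x,y)$, and $L_G=\frac1{m_G}\sum_{i=1}^{m_G}L_G^i$. Assume additionally $\mu_x\le L_G$, $\mu_x\le L_f$ and $\mu_y\le L_G$. Then for any $\varepsilon>0$ there is a (deterministic) algorithm that finds an $\varepsilon$-solution to this problem with the following numbers of basic oracle calls: $$\nabla f:\ \widetilde O\left(\sqrt{\frac{L_GL_f}{\mu_x\mu_y}}\right),\qquad\nabla h:\ \widetilde O\left(\sqrt{\frac{L_G}{\mu_y}}\right),$$ $$\nabla_xG_i:\ \widetilde O\left(m_G\sqrt{\frac{L_G^2}{\mu_x\mu_y}}\right),\qquad\nabla_yG_i:\ \widetilde O\left(m_G\sqrt{\frac{L_G^2}{\mu_x\mu_y}}\right).$$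
   Context: Norms are Euclidean. A function is $L$-smooth if its gradient is $L$-Lipschitz; for $G_i$: $\|\nabla G_i(x_1,x_2)-\nabla G_i(y_1,y_2)\|\le L_G^i\|(x_1,x_2)-(y_1,y_2)\|$ on $\mathbb{R}^{d_x}\times\mathbb{R}^{d_y}$. A basic oracle call is one evaluation of $\nabla f(x)$, of $\nabla h(y)$, of one $\nabla_xG_i(x,y)$, or of one $\nabla_yG_i(x,y)$, respectively. The function $h$ being prox-friendly means that the algorithm may solve exactly (at no gradient-call cost) any problem $\min_y\{\langle c_1,y\rangle+h(y)+\frac{c_2}2\|y-\bar y\|^2\}$ with fixed $c_1,\bar y\in\mathbb{R}^{d_y}$, $c_2>0$. $\widetilde O(X)$ hides constant factors and factors polylogarithmic in $\varepsilon^{-1}$. A point $\hat y$ is an $\varepsilon$-solution of the saddle-point problem if $h(\hat y)+\max_{x}\{-G(x,\hat y)-f(x)\}-\min_{y}\max_{x}\{h(y)-G(x,y)-f(x)\}\le\varepsilon$. *)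

(* Defs.v *)
(* MathComp-Analysis, over an arbitrary [R : realType]. *)
From HB Require Import structures.
From mathcomp Require Export all_boot all_order all_algebra.
From mathcomp Require Export all_classical all_reals all_analysis.
Export numFieldNormedType.Exports.
Set Implicit Arguments.
Unset Strict Implicit.
Unset Printing Implicit Defensive.
Import Order.TTheory GRing.Theory Num.Theory.
Local Open Scope classical_set_scope.
Local Open Scope ring_scope.

(* The library norm on matrices is the sup norm, hence these Euclidean
   counterparts. *)
Definition dot (R : realType) (n : nat) (u v : 'rV[R]_n) : R :=
  \sum_(i < n) u 0 i * v 0 i.

Definition norm2 (R : realType) (n : nat) (u : 'rV[R]_n) : R :=
  Num.sqrt (dot u u).

(* Meaningful when [f] is differentiable at [x]. *)
Definition grad (R : realType) (n : nat) (f : 'rV[R]_n -> R) (x : 'rV[R]_n) :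
    'rV[R]_n :=
  \row_(i < n) 'D_(delta_mx 0 i) f x.

Definition smooth (R : realType) (n : nat) (L : R) (f : 'rV[R]_n -> R) : Prop :=
  [/\ 0 <= L,
      forall x, differentiable f x &
      forall x y, norm2 (grad f x - grad f y) <= L * norm2 (x - y)].

Definition strongly_convex (R : realType) (n : nat) (mu : R)
    (f : 'rV[R]_n -> R) : Prop :=
  forall (x y : 'rV[R]_n) (t : R), 0 <= t <= 1 ->
    f (t *: x + (1 - t) *: y) <=
      t * f x + (1 - t) * f y - mu / 2 * t * (1 - t) * norm2 (x - y) ^+ 2.

Definition is_max (R : realType) (T : Type) (F : T -> R) (v : R) : Prop :=
  (exists x, F x = v) /\ (forall x, F x <= v).

Definition is_min (R : realType) (T : Type) (F : T -> R) (v : R) : Prop :=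
  (exists x, F x = v) /\ (forall x, v <= F x).

Definition average (R : realType) (m : nat) (a : 'I_m -> R) : R :=
  m%:R^-1 * \sum_(i < m) a i.

(* [g] as a function of the concatenated variable [(x, y)]. *)
Definition joint (R : realType) (dx dy : nat)
    (g : 'rV[R]_dx -> 'rV[R]_dy -> R) (z : 'rV[R]_(dx + dy)) : R :=
  g (lsubmx z) (rsubmx z).

Record problem_class (R : realType) (dx dy m : nat)
    (mux muy Lf Lh : R) (LG : 'I_m -> R)
    (f : 'rV[R]_dx -> R) (h : 'rV[R]_dy -> R)
    (G : 'I_m -> 'rV[R]_dx -> 'rV[R]_dy -> R) : Prop := ProblemClass {
  f_strongly_convex : strongly_convex mux f;
  f_smooth : smooth Lf f;
  h_strongly_convex : strongly_convex muy h;
  h_smooth : smooth Lh h;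
  G_convex : forall i y, convex_function setT (fun x => G i x y);
  G_concave : forall i x, convex_function setT (fun y => - G i x y);
  G_smooth : forall i, smooth (LG i) (joint (G i))
}.

Definition saddle_point (R : realType) (dx dy : nat)
    (f : 'rV[R]_dx -> R) (h : 'rV[R]_dy -> R)
    (G : 'rV[R]_dx -> 'rV[R]_dy -> R)
    (xs : 'rV[R]_dx) (ys : 'rV[R]_dy) : Prop :=
  (forall y, f xs + G xs y - h y <= f xs + G xs ys - h ys) /\
  (forall x, f xs + G xs ys - h ys <= f x + G x ys - h ys).

(* [h yhat + max_x (- G x yhat - f x) - min_y max_x (h y - G x y - f x) <= eps],
   all extrema being attained. *)
Definition eps_solution (R : realType) (dx dy : nat)
    (f : 'rV[R]_dx -> R) (h : 'rV[R]_dy -> R)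
    (G : 'rV[R]_dx -> 'rV[R]_dy -> R) (eps : R) (yhat : 'rV[R]_dy) : Prop :=
  exists (v opt : R) (psi : 'rV[R]_dy -> R),
    [/\ is_max (fun x => - G x yhat - f x) v,
        forall y, is_max (fun x => h y - G x y - f x) (psi y),
        is_min psi opt &
        h yhat + v - opt <= eps].

(* A deterministic algorithm is a well-founded decision tree: each query may
   depend on all the answers received so far, and only queries cost anything.
   It has no other access to [f], [h] and [G].  [Prox c1 ybar c2] asks for
   the minimizer over [y] of [<c1, y> + h y + c2 / 2 * |y - ybar| ^ 2]. *)
Inductive query (R : realType) (dx dy m : nat) : Type :=
| GradF of 'rV[R]_dx
| GradH of 'rV[R]_dy
| GradGx of 'I_m & 'rV[R]_dx & 'rV[R]_dy
| GradGy of 'I_m & 'rV[R]_dx & 'rV[R]_dy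
| Prox of 'rV[R]_dy & 'rV[R]_dy & {posnum R}.

Arguments GradF {R dx dy m} x.
Arguments GradH {R dx dy m} y.
Arguments GradGx {R dx dy m} i x y.
Arguments GradGy {R dx dy m} i x y.
Arguments Prox {R dx dy m} c1 ybar c2.

Definition answer (R : realType) (dx dy m : nat) (q : query R dx dy m) : Type :=
  match q with
  | GradF _ | GradGx _ _ _ => 'rV[R]_dx
  | GradH _ | GradGy _ _ _ | Prox _ _ _ => 'rV[R]_dy
  end.

Definition oracle (R : realType) (dx dy m : nat) : Type :=
  forall q : query R dx dy m, answer q.

Record oracle_for (R : realType) (dx dy m : nat)
    (f : 'rV[R]_dx -> R) (h : 'rV[R]_dy -> R)
    (G : 'I_m -> 'rV[R]_dx -> 'rV[R]_dy -> R)
    (o : oracle R dx dy m) : Prop := OracleFor {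
  oracle_f : forall x, o (GradF x) = grad f x;
  oracle_h : forall y, o (GradH y) = grad h y;
  oracle_Gx : forall i x y, o (GradGx i x y) = grad (fun x' => G i x' y) x;
  oracle_Gy : forall i x y, o (GradGy i x y) = grad (fun y' => G i x y') y;
  oracle_prox : forall c1 ybar (c2 : {posnum R}),
    let obj y := dot c1 y + h y + c2%:num / 2 * norm2 (y - ybar) ^+ 2 in
    forall y, obj (o (Prox c1 ybar c2)) <= obj y
}.

Inductive algorithm (R : realType) (dx dy m : nat) : Type :=
| Output of 'rV[R]_dy
| Ask (q : query R dx dy m) of (answer q -> algorithm R dx dy m).

Fixpoint output (R : realType) (dx dy m : nat) (o : oracle R dx dy m)
    (A : algorithm R dx dy m) : 'rV[R]_dy :=
  match A with
  | Output y => y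
  | Ask q k => output o (k (o q))
  end.

Fixpoint calls (R : realType) (dx dy m : nat) (P : pred (query R dx dy m))
    (o : oracle R dx dy m) (A : algorithm R dx dy m) : nat :=
  match A with
  | Output _ => 0
  | Ask q k => (P q + calls P o (k (o q)))%N
  end.

Definition is_gradF (R : realType) (dx dy m : nat) (q : query R dx dy m) :=
  if q is GradF _ then true else false.
Definition is_gradH (R : realType) (dx dy m : nat) (q : query R dx dy m) :=
  if q is GradH _ then true else false.
Definition is_gradGx (R : realType) (dx dy m : nat) (q : query R dx dy m) :=
  if q is GradGx _ _ _ then true else false.
Definition is_gradGy (R : realType) (dx dy m : nat) (q : query R dx dy m) :=
  if q is GradGy _ _ _ then true else false.

(* Base of the factor hidden by the soft-O notation: logarithmic in
   [eps^-1], and in a scale [S] made of the constants of the problem and of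
   the distance from the starting point to the solution. *)
Definition logfactor (R : realType) (eps S : R) : R :=
  1 + ln (1 + eps^-1) + ln (1 + S).

(* Main.v *)
(* Minimizing the dual function [h y + max_x (- G x y - f x)] by the accelerated
   proximal point method, with proximal parameter [LG], takes about
   [sqrt (LG / muy)] steps.  A step is the saddle-point problem with the extra
   term [- LG / 2 * |y - yb| ^ 2]; exchanging min and max, it minimizes over [x]
   the sum of [f] and of a primal function whose gradient is [2 LG]-Lipschitz,
   because the inner maximizer is 1-Lipschitz in [x].  Gradient sliding does
   this with about [sqrt (Lf / mux)] gradients of [f] and [sqrt (LG / mux)]
   gradients of the primal function, and each of the latter costs a logarithmic
   number of proximal gradient steps in [y], where the condition number is
   bounded and [h] is handled by its exact prox.  All four loops are instances
   of one accelerated composite method whose Lyapunov function contracts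
   geometrically under errors proportional to the distance to the solution plus
   a fixed radius, so the inner loops need a relative accuracy only, independent
   of the iterate they start from.  One gradient evaluation at the starting
   point bounds its distance to the solution, by strong monotonicity, and this
   fixes all the iteration counts in advance. *)
Require Import Defs.
From mathcomp Require Import ring lra.
Set Implicit Arguments.
Unset Strict Implicit.
Unset Printing Implicit Defensive.
Import Order.TTheory GRing.Theory Num.Theory.
Local Open Scope classical_set_scope.
Local Open Scope ring_scope.

(** * Euclidean vectors *)

(** Sliding must linearize the smoother of two terms and keep the strong convexity in the other.
    Which of [f] and the primal function is smoother depends on whether [2 * LG <= Lf]; in the other
    case the quadratic [mux / 2 * |x| ^ 2] is moved from [f] to the primal function before the roles
    are swapped. The analysis uses first-order inequalities only: functions come paired with
    gradient maps, value functions get their gradients from the extremality of the inner point, and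
    every optimizer exists as a zero of a strongly monotone Lipschitz map. The price is a factor 2
    in some smoothness constants. Each layer loses a polynomial factor in the constants of the
    problem. All accuracies are therefore powers of one small number [b], and a single [Lam] with
    [expR (- Lam) = b ^+ 30] sets the length of every loop. Since [h] is handled by its exact prox,
    [Lh] enters through [Lam] alone, hence under a logarithm. *)

Section Euclid.
Context {R : realType} {n : nat}.
Implicit Types (u v w : 'rV[R]_n) (a : R).

Lemma dotC u v : dot u v = dot v u.
Proof. by apply: eq_bigr => i _; rewrite mulrC. Qed.

Lemma dotDl u v w : dot (u + v) w = dot u w + dot v w.
Proof. by rewrite /dot -big_split; apply: eq_bigr => i _; rewrite mxE mulrDl. Qed.

Lemma dotZl a u v : dot (a *: u) v = a * dot u v.
Proof. by rewrite /dot mulr_sumr; apply: eq_bigr => i _; rewrite mxE mulrA. Qed.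

Lemma dotNl u v : dot (- u) v = - dot u v.
Proof. by rewrite -scaleN1r dotZl mulN1r. Qed.

Lemma dot0l v : dot 0 v = 0.
Proof. by rewrite -(scale0r 0) dotZl mul0r. Qed.

Lemma dotDr u v w : dot w (u + v) = dot w u + dot w v.
Proof. by rewrite dotC dotDl !(dotC w). Qed.

Lemma dotZr a u v : dot v (a *: u) = a * dot v u.
Proof. by rewrite dotC dotZl dotC. Qed.

Lemma dotNr u v : dot v (- u) = - dot v u.
Proof. by rewrite dotC dotNl dotC. Qed.

Lemma dot0r v : dot v 0 = 0.
Proof. by rewrite dotC dot0l. Qed.

Definition dotE :=
  (dotDl, dotDr, dotZl, dotZr, dotNl, dotNr, dot0l, dot0r).

Lemma dot_ge0 u : 0 <= dot u u.
Proof. by apply: sumr_ge0 => i _; rewrite -expr2 sqr_ge0. Qed.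

Lemma norm2_ge0 u : 0 <= norm2 u.
Proof. exact: sqrtr_ge0. Qed.

Lemma sqr_norm2 u : norm2 u ^+ 2 = dot u u.
Proof. by rewrite sqr_sqrtr ?dot_ge0. Qed.

Lemma norm2Z a u : norm2 (a *: u) = `|a| * norm2 u.
Proof.
by rewrite /norm2 !dotE mulrA -expr2 sqrtrM ?sqr_ge0 // sqrtr_sqr.
Qed.

Lemma norm2N u : norm2 (- u) = norm2 u.
Proof. by rewrite /norm2 !dotE opprK. Qed.

Lemma norm20 : norm2 (0 : 'rV[R]_n) = 0.
Proof. by rewrite /norm2 dotE sqrtr0. Qed.

Lemma norm2B u v : norm2 (u - v) = norm2 (v - u).
Proof. by rewrite -norm2N opprB. Qed.

Lemma coord_le_norm2 u i : `|u 0 i| <= norm2 u.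
Proof.
rewrite -(@ler_pXn2r _ 2) ?nnegrE ?norm2_ge0 // sqr_norm2 real_normK ?num_real //.
rewrite /dot (bigD1 i) //= expr2 lerDl.
by apply: sumr_ge0 => j _; rewrite -expr2 sqr_ge0.
Qed.

Lemma norm2_eq0 u : norm2 u = 0 -> u = 0.
Proof.
move=> u0; apply/rowP => i; rewrite mxE.
by have := coord_le_norm2 u i; rewrite u0 normr_le0 => /eqP.
Qed.

Lemma dot_eq0 u : dot u u = 0 -> u = 0.
Proof. by move=> u0; apply: norm2_eq0; rewrite /norm2 u0 sqrtr0. Qed.

End Euclid.

Ltac row_ring := apply/rowP => ?; rewrite !mxE; ring.
Ltac row_field := apply/rowP => ?; rewrite !mxE; field.
Ltac sort_dot := repeat match goal with |- context [dot ?a ?b] =>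
  match goal with |- context [dot b a] =>
    tryif constr_eq a b then fail else rewrite (dotC b a) end end.

Ltac dot_expand := rewrite ?sqr_norm2 !dotE; sort_dot.

Section CauchySchwarz.
Context {R : realType} {n : nat}.
Implicit Types (u v w : 'rV[R]_n) (a : R).

Lemma dot_le_norm2 u v : dot u v <= norm2 u * norm2 v.
Proof.
have [/norm2_eq0 ->|nu] := eqVneq (norm2 u) 0; first by rewrite dotE norm20 mul0r.
have [/norm2_eq0 ->|nv] := eqVneq (norm2 v) 0; first by rewrite dotE norm20 mulr0.
have pu : 0 < norm2 u by rewrite lt_def nu norm2_ge0.
have pv : 0 < norm2 v by rewrite lt_def nv norm2_ge0.
have := dot_ge0 (norm2 v *: u - norm2 u *: v).
dot_expand; rewrite -!sqr_norm2.
set a := norm2 u in nu pu *; set b := norm2 v in nv pv *.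
move=> H; have : 0 <= (2 * (a * b)) * (a * b - dot u v) by lra.
by rewrite pmulr_rge0 ?mulr_gt0 // subr_ge0.
Qed.

Lemma norm2_leP u a : 0 <= a -> (norm2 u <= a) = (dot u u <= a ^+ 2).
Proof. by move=> a0; rewrite -sqr_norm2 ler_pXn2r ?nnegrE ?norm2_ge0. Qed.

Lemma norm2D u v : norm2 (u + v) <= norm2 u + norm2 v.
Proof.
rewrite norm2_leP ?addr_ge0 ?norm2_ge0 //.
by have := dot_le_norm2 u v; dot_expand; rewrite -!sqr_norm2; lra.
Qed.

Lemma norm2_tri w u v : norm2 (u - v) <= norm2 (u - w) + norm2 (w - v).
Proof. by rewrite -{1}(subrK w u) -addrA norm2D. Qed.

Lemma norm2_sum (I : Type) (r : seq I) (F : I -> 'rV[R]_n) :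
  norm2 (\sum_(i <- r) F i) <= \sum_(i <- r) norm2 (F i).
Proof.
elim/big_ind2 : _ => [|x a y b xa yb|//]; first by rewrite norm20.
exact: le_trans (norm2D _ _) (lerD xa yb).
Qed.

End CauchySchwarz.

Section Rows.
Context {R : realType} {n m : nat}.

Lemma dot_row_mx (a c : 'rV[R]_n) (b d : 'rV[R]_m) :
  dot (row_mx a b) (row_mx c d) = dot a c + dot b d.
Proof.
by rewrite /dot big_split_ord /=; congr (_ + _); apply: eq_bigr => i _;
   rewrite ?row_mxEl ?row_mxEr.
Qed.

Lemma norm2_lsubmx (z : 'rV[R]_(n + m)) : norm2 (lsubmx z) <= norm2 z.
Proof.
by rewrite /norm2 ler_sqrt ?dot_ge0 // -{3 4}(hsubmxK z) dot_row_mx lerDl dot_ge0.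
Qed.

Lemma norm2_rsubmx (z : 'rV[R]_(n + m)) : norm2 (rsubmx z) <= norm2 z.
Proof.
by rewrite /norm2 ler_sqrt ?dot_ge0 // -{3 4}(hsubmxK z) dot_row_mx lerDr dot_ge0.
Qed.

Lemma norm2_row_mx (a : 'rV[R]_n) (b : 'rV[R]_m) :
  norm2 (row_mx a b) <= norm2 a + norm2 b.
Proof.
rewrite norm2_leP ?addr_ge0 ?norm2_ge0 // dot_row_mx -!sqr_norm2 sqrrD.
by rewrite lerD2r lerDl mulrn_wge0 // mulr_ge0 ?norm2_ge0.
Qed.

Lemma norm2_row_mxl (a : 'rV[R]_n) (b : 'rV[R]_m) :
  norm2 a <= norm2 (row_mx a b).
Proof. by have := norm2_lsubmx (row_mx a b); rewrite row_mxKl. Qed.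

Lemma norm2_row_mxr (a : 'rV[R]_n) (b : 'rV[R]_m) :
  norm2 b <= norm2 (row_mx a b).
Proof. by have := norm2_rsubmx (row_mx a b); rewrite row_mxKr. Qed.

End Rows.

(** * Zeros of strongly monotone Lipschitz maps *)

Section Monotone.
Context {R : realType} {n : nat}.
Implicit Types (F g : 'rV[R]_n -> 'rV[R]_n).

Definition lip (L : R) (m : nat) (F : 'rV[R]_n -> 'rV[R]_m) :=
  forall x y, norm2 (F x - F y) <= L * norm2 (x - y).

Definition monotone (mu : R) F :=
  forall x y, mu * dot (x - y) (x - y) <= dot (F x - F y) (x - y).

Lemma monotone_norm (mu : R) F x y : monotone mu F ->
  mu * norm2 (x - y) <= norm2 (F x - F y).
Proof.
move=> mF; have [->|nz] := eqVneq (norm2 (x - y)) 0.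
  by rewrite mulr0 norm2_ge0.
have p : 0 < norm2 (x - y) by rewrite lt_def nz norm2_ge0.
rewrite -(ler_pM2r p) -mulrA -expr2 sqr_norm2.
exact: le_trans (mF x y) (dot_le_norm2 _ _).
Qed.

(** Each coordinate is a telescoping series dominated by a geometric one, and the squared distance
    to the vector of limits is a finite sum of products tending to 0. *)
Lemma cauchy_geometric (x : nat -> 'rV[R]_n) (c q : R) :
  0 <= q < 1 -> (forall k, norm2 (x k.+1 - x k) <= c * q ^+ k) ->
  exists z, (fun k => norm2 (x k - z)) @ \oo --> (0 : R).
Proof.
move=> /andP[q0 q1] H.
have C i : cvgn (fun k => x k 0 i).
  set u := fun k => x k 0 i.
  have : cvgn (series (telescope u)).
    apply: normed_cvg; apply: (@series_le_cvg _ _ (geometric c q)) => [k|k|k|].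
    - by rewrite normr_ge0.
    - exact: le_trans (norm2_ge0 _) (H k).
    - apply: le_trans (H k) => /=.
      by rewrite /telescope /u; have := coord_le_norm2 (x k.+1 - x k) i; rewrite !mxE.
    - by apply: is_cvg_geometric_series; rewrite ger0_norm.
  move=> cs; have -> : u = (fun k => u 0%N + series (telescope u) k).
    by apply/funext => k; rewrite -eq_sum_telescope.
  by apply: is_cvgD cs; exact: is_cvg_cst.
exists (\row_i limn (fun k => x k 0 i)).
rewrite /norm2 -[X in _ --> X]sqrtr0.
apply: (@continuous_cvg _ _ _ _ _ (fun k => dot (x k - _) (x k - _)) Num.sqrt).
  exact: sqrt_continuous.
rewrite -(_ : \sum_(i < n) 0 * 0 = 0 :> R); last first.
  by rewrite big1 // => i _; rewrite mul0r.
rewrite /dot; apply: (cvg_big add_continuous) => i _.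
have c0 : (fun k => x k 0 i - limn (fun k => x k 0 i)) @ \oo --> (0 : R).
  rewrite -(subrr (limn (fun k => x k 0 i))).
  by apply: cvgB; [exact: C | exact: cvg_cst].
rewrite (_ : (fun k => _) = (fun k => (x k 0 i - limn (fun k => x k 0 i)) *
   (x k 0 i - limn (fun k => x k 0 i)))); last by apply/funext => k; rewrite !mxE.
exact: cvgM.
Qed.

(* The map [z - eta F z] is a contraction for [eta = mu / L ^ 2]. *)
Lemma monotone_zero (mu L : R) F : 0 < mu -> monotone mu F -> lip L F ->
  exists z, F z = 0.
Proof.
(* Enlarging [L] to [K] ensures [mu / K <= 1], so that [1 - (mu / K) ^+ 2] is nonnegative and its
   root [q] is a contraction factor. *)
move=> mu0 mF lF; pose K := L + mu.
have [/norm2_eq0 ?|F0] := eqVneq (norm2 (F 0)) 0; first by exists 0.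
(* A negative [L] would make every distance vanish, against [F 0 != 0]. *)
have L0 : 0 <= L.
  rewrite leNgt; apply/negP => Ln.
  have Z (u v : 'rV[R]_n) : norm2 (u - v) = 0.
    by have := lF u v; have := norm2_ge0 (F u - F v); have := norm2_ge0 (u - v); nra.
  by have := Z (F 0) 0; rewrite subr0; apply/eqP.
have K0 : 0 < K by rewrite /K; lra.
have lK : lip K F.
  move=> u v; apply: le_trans (lF u v) _.
  by rewrite ler_wpM2r ?norm2_ge0 // /K; lra.
pose e := mu / K ^+ 2; have e0 : 0 < e by rewrite divr_gt0 ?exprn_gt0.
pose q := Num.sqrt (1 - (mu / K) ^+ 2).
have muK : mu / K <= 1 by rewrite ler_pdivrMr // mul1r /K; lra.
have muK0 : 0 < mu / K by rewrite divr_gt0.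
have q2 : q ^+ 2 = 1 - (mu / K) ^+ 2 by rewrite sqr_sqrtr //; nra.
have q0 : 0 <= q by exact: sqrtr_ge0.
have q1 : q < 1 by rewrite -(@ltr_pXn2r _ 2) ?nnegrE // q2 expr1n; nra.
pose T z := z - e *: F z.
have cT (u v : 'rV[R]_n) : norm2 (T u - T v) <= q * norm2 (u - v).
  rewrite norm2_leP ?mulr_ge0 ?norm2_ge0 // exprMn q2 sqr_norm2.
  have -> : T u - T v = (u - v) - e *: (F u - F v).
    by rewrite /T; row_ring.
  have lab := lK u v; rewrite norm2_leP ?mulr_ge0 ?norm2_ge0 ?(ltW K0) // in lab.
  rewrite exprMn sqr_norm2 in lab; have mab := mF u v.
  move: (u - v) (F u - F v) lab mab => a b; dot_expand => lab mab.
  have -> : (mu / K) ^+ 2 = e * mu by rewrite /e; field; rewrite gt_eqF.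
  have E : e * (e * dot b b) <= e * mu * dot a a.
    rewrite -mulrA ler_pM2l //.
    have -> : mu * dot a a = e * (K ^+ 2 * dot a a) by rewrite /e; field; rewrite gt_eqF.
    by rewrite ler_pM2l.
  by have := ler_wpM2l (ltW e0) mab; lra.
pose x := fun k => iter k T 0.
have [|k|z cz] := @cauchy_geometric x (norm2 (T 0 - 0)) q; first by rewrite q0.
  elim: k => [|k IH]; first by rewrite expr0 mulr1.
  by apply: le_trans (cT _ _) _; rewrite exprS mulrCA ler_wpM2l.
exists z; apply: norm2_eq0; apply/eqP; rewrite eq_le norm2_ge0 andbT.
(* [F (x k)] equals [e^-1 *: (x k - x k.+1)], so [F z] is controlled by two consecutive distances to
   [z], and both tend to 0. *)
have B k : norm2 (F z) <= (K + 2 / e) * norm2 (x k - z) + e^-1 * norm2 (x k.+1 - z).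
  have -> : F z = - (F (x k) - F z) + e^-1 *: ((x k - z) - (x k.+1 - z)).
    by rewrite /= /T -/(x k); row_field; rewrite gt_eqF.
  apply: le_trans (norm2D _ _) _; rewrite norm2N norm2Z gtr0_norm ?invr_gt0 //.
  have := norm2D (x k - z) (- (x k.+1 - z)); rewrite norm2N => H.
  have := lK (x k) z; have ei : 0 < e^-1 by rewrite invr_gt0.
  have := ler_wpM2l (ltW ei) H; have := norm2_ge0 (x k - z); nra.
have C : (fun k => (K + 2 / e) * norm2 (x k - z) + e^-1 * norm2 (x k.+1 - z))
   @ \oo --> ((K + 2 / e) * 0 + e^-1 * 0 : R).
  apply: cvgD; (apply: cvgM; first exact: cvg_cst); first exact: cz.
  by rewrite (cvg_shiftS (fun k => norm2 (x k - z))).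
move: C; rewrite !mulr0 addr0 => C.
rewrite -(cvg_lim _ C) //; apply: limr_ge; first by apply: cvgP C.
by apply: nearW => k; exact: B.
Qed.

End Monotone.

(** * Inexact accelerated composite minimization *)

Section Convex.
Context {R : realType} {n : nat}.
Implicit Types (F : 'rV[R]_n -> R) (g : 'rV[R]_n -> 'rV[R]_n).

(** First-order strong convexity with the gradient map as data. The optimization layer uses only
    this inequality, and [mu] may be split or shifted between the terms of a sum. *)
Definition cvx_grad (mu : R) F g := forall x u,
  F x + dot (g x) (u - x) + mu / 2 * dot (u - x) (u - x) <= F u.

Lemma cvx_grad_monotone mu F g : cvx_grad mu F g -> monotone mu g.
Proof.
move=> c x y; have := c x y; have := c y x.
have -> : y - x = - (x - y) by row_ring.
by dot_expand; lra.
Qed.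

Lemma cvx_gradW mu F g : 0 <= mu -> cvx_grad mu F g -> cvx_grad 0 F g.
Proof.
move=> m0 c x u; apply: le_trans (c x u); rewrite lerD2l !mul0r.
by rewrite mulr_ge0 ?dot_ge0 // divr_ge0.
Qed.

Lemma cvx_gradD mu nu F G gF gG : cvx_grad mu F gF -> cvx_grad nu G gG ->
  cvx_grad (mu + nu) (fun x => F x + G x) (fun x => gF x + gG x).
Proof.
move=> cF cG x u; have := cF x u; have := cG x u; rewrite dotDl /=.
by move: (dot (u - x) (u - x)) => d; lra.
Qed.

Lemma cvx_grad_shift mu F g c : cvx_grad mu F g ->
  cvx_grad (mu + c) (fun x => F x + c / 2 * dot x x) (fun x => g x + c *: x).
Proof.
move=> cF; apply: cvx_gradD cF _ => x u.
by rewrite le_eqVlt; apply/orP; left; apply/eqP; rewrite /=; dot_expand; field.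
Qed.

Lemma lipW (m : nat) (L M : R) (g : 'rV[R]_n -> 'rV[R]_m) :
  L <= M -> lip L g -> lip M g.
Proof.
by move=> LM lg x y; apply: le_trans (lg x y) _; rewrite ler_wpM2r ?norm2_ge0.
Qed.

Lemma lipD (m : nat) (L M : R) (g h : 'rV[R]_n -> 'rV[R]_m) :
  lip L g -> lip M h -> lip (L + M) (fun x => g x + h x).
Proof.
move=> lg lh x y; rewrite opprD addrACA mulrDl.
exact: le_trans (norm2D _ _) (lerD (lg x y) (lh x y)).
Qed.

Lemma lipN (m : nat) (L : R) (g : 'rV[R]_n -> 'rV[R]_m) :
  lip L g -> lip L (fun x => - g x).
Proof. by move=> lg x y; rewrite -opprD norm2N. Qed.

Lemma lip_affine (c : R) (a : 'rV[R]_n) : 0 <= c -> lip c (fun x => c *: (x - a)).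
Proof.
move=> c0 x y; rewrite -scalerBr (_ : x - a - _ = x - y); last by row_ring.
by rewrite norm2Z ger0_norm.
Qed.

Lemma lip_scale (c : R) : lip `|c| (fun x : 'rV[R]_n => c *: x).
Proof. by move=> x y; rewrite -scalerBr norm2Z. Qed.

Lemma lip_dot (L : R) g x y : lip L g ->
  dot (g x - g y) (x - y) <= L * dot (x - y) (x - y).
Proof.
move=> lg; apply: le_trans (dot_le_norm2 _ _) _.
by rewrite -sqr_norm2 expr2 mulrA ler_wpM2r ?norm2_ge0.
Qed.

(** Three-point form: convexity between [u] and [y] together with smoothness between [y] and [x]. A
    step uses it with [u] the previous iterate and with [u] the solution. *)
Definition descent (L : R) F g := forall u y x,
  F x <= F u + dot (g y) (x - u) + L / 2 * dot (x - y) (x - y).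

(* With [2 L] in place of [L] the descent inequality needs no integration. *)
Lemma lip_descent (L : R) F g : cvx_grad 0 F g -> lip L g ->
  descent (2 * L) F g.
Proof.
move=> c lg u y x.
have := c y u; have := c x y; have := @lip_dot L g x y lg.
have -> : y - x = - (x - y) by row_ring.
have -> : x - u = (x - y) - (u - y) by row_ring.
by rewrite !mul0r !addr0; dot_expand; lra.
Qed.

(** Convexity at [x] bounds the gap by [dot (g x - g xs) (x - xs)], and Cauchy-Schwarz finishes; the
    constant is twice the sharp one. *)
Lemma cvx_grad_gap (L : R) F g xs x : cvx_grad 0 F g -> lip L g -> g xs = 0 ->
  F x - F xs <= L * dot (x - xs) (x - xs).
Proof.
move=> c lg g0; have := c x xs; have := @lip_dot L g x xs lg; rewrite g0 subr0.
have -> : xs - x = - (x - xs) by row_ring.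
by rewrite !mul0r addr0; dot_expand; lra.
Qed.

End Convex.

Lemma dot_young {R : realType} {n : nat} (u w : 'rV[R]_n) (mu : R) : 0 < mu ->
  - dot u w <= dot u u / mu + mu / 4 * dot w w.
Proof.
move=> mu0; have := dot_ge0 (u + (mu / 2) *: w); dot_expand => h.
by rewrite -(ler_pM2r mu0) mulrDl divfK ?gt_eqF //; lra.
Qed.

Section AGD.
Context {R : realType} {n : nat}.
Local Notation V := 'rV[R]_n.
Implicit Types (s : V * V).

(* The root [t] of [t ^ 2 * (L + mu) = mu], for which a step contracts the
   Lyapunov function by [1 - t]. *)
Definition agd_rate (L mu : R) : R := Num.sqrt (mu / (L + mu)).

(** A state pairs the iterate [s.1] with the auxiliary point [s.2], which carries the momentum and
    appears squared in the Lyapunov function. *)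
Definition agd_extrapolate (t : R) s : V :=
  (1 + t)^-1 *: (s.1 + t *: s.2).

Definition agd_update (t : R) s (x : V) : V * V :=
  (x, s.1 + t^-1 *: (x - s.1)).

(** An inexact step contracts by [1 - t / 4], so this many steps reach the factor [expR (- Lam)]. *)
Definition agd_steps (Lam t : R) : nat := (Num.truncn (4 * Lam / t)).+1.

(** [prox y] is any approximate minimizer of [<gP y, x> + Q x + L / 2 * |x - y| ^ 2] over [x]; the
    analysis measures it by the residual of the optimality condition. *)
Definition agd (L mu Lam : R) (prox : V -> V) (x : V) : V :=
  let t := agd_rate L mu in
  (iter (agd_steps Lam t)
     (fun s => agd_update t s (prox (agd_extrapolate t s))) (x, x)).1.

Lemma agd_rate_gt0 L mu : 0 < L -> 0 < mu -> 0 < agd_rate L mu.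
Proof. by move=> L0 m0; rewrite sqrtr_gt0 divr_gt0 // addr_gt0. Qed.

Lemma sqr_agd_rate L mu : 0 < L -> 0 < mu ->
  agd_rate L mu ^+ 2 = mu / (L + mu).
Proof. by move=> L0 m0; rewrite sqr_sqrtr // divr_ge0 // ltW // addr_gt0. Qed.

Lemma agd_rate_lt1 L mu : 0 < L -> 0 < mu -> agd_rate L mu < 1.
Proof.
move=> L0 m0; rewrite -(@ltr_pXn2r _ 2) ?nnegrE ?ltW ?agd_rate_gt0 //.
by rewrite sqr_agd_rate // expr1n ltr_pdivrMr ?addr_gt0 // mul1r ltrDr.
Qed.

Lemma agd_steps_exp (Lam t : R) : 0 <= Lam -> 0 < t < 1 ->
  (1 - t / 4) ^+ agd_steps Lam t <= expR (- Lam).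
Proof.
move=> Lam0 /andP[t0 t1].
have := expR_ge1Dx (- (t / 4)) => H.
apply: (@le_trans _ _ (expR (- (t / 4)) ^+ agd_steps Lam t)).
  by apply: lerXn2r; rewrite ?nnegrE ?expR_ge0 //; lra.
rewrite -expRM_natl ler_expR mulrN lerN2.
have /andP[_ h] : (Num.truncn (4 * Lam / t))%:R <= 4 * Lam / t <
    (agd_steps Lam t)%:R.
  by apply: truncn_itv; rewrite divr_ge0 ?mulr_ge0 // ltW.
by move: h; rewrite ltr_pdivrMr // => h; lra.
Qed.

Lemma agd_steps_le (Lam t : R) : 1 <= Lam -> 0 < t < 1 ->
  (agd_steps Lam t)%:R <= 5 * Lam / t.
Proof.
move=> Lam0 /andP[t0 t1]; rewrite /agd_steps -natr1.
have L0 : 0 <= Lam by lra.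
have /andP[h _] : (Num.truncn (4 * Lam / t))%:R <= 4 * Lam / t <
   (Num.truncn (4 * Lam / t)).+1%:R.
  by apply: truncn_itv; rewrite divr_ge0 ?mulr_ge0 // ltW.
have : 1 <= Lam / t by rewrite ler_pdivlMr //; lra.
by rewrite -!mulrA in h *; lra.
Qed.

Section Analysis.
Variables (L mu : R) (P Q : V -> R) (gP gQ : V -> V) (xs : V).
Hypotheses (L_gt0 : 0 < L) (mu_gt0 : 0 < mu).
Hypotheses (P_cvx : cvx_grad 0 P gP) (P_descent : descent L P gP).
Hypotheses (Q_cvx : cvx_grad mu Q gQ) (xs_opt : gP xs + gQ xs = 0).

Let t := agd_rate L mu.
Let t0 : 0 < t. Proof. exact: agd_rate_gt0. Qed.
Let t1 : t < 1. Proof. exact: agd_rate_lt1. Qed.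

Definition lyapunov s : R :=
  (P s.1 + Q s.1) - (P xs + Q xs) + mu / 2 * dot (s.2 - xs) (s.2 - xs).

(** Strong convexity at [xs] turns the gap into a squared distance. The Lyapunov function thus
    controls both points of the state, which lets it absorb errors proportional to the distance. *)
Lemma lyapunov_ge s :
  mu / 2 * (dot (s.1 - xs) (s.1 - xs) + dot (s.2 - xs) (s.2 - xs)) <= lyapunov s.
Proof.
have := P_cvx xs s.1; have := Q_cvx xs s.1; rewrite /lyapunov.
rewrite (_ : gP xs = - gQ xs); last by apply/eqP; rewrite -addr_eq0 xs_opt.
by rewrite dotNl mul0r mul0r; move: (dot (gQ _) _) (dot (_ - _) _) => a b; lra.
Qed.

Lemma agd_step s x :
  let y := agd_extrapolate t s in
  let e := L *: (y - x) - gP y - gQ x in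
  let s' := agd_update t s x in
  lyapunov s' <= (1 - t) * lyapunov s - t * dot e (s'.2 - xs).
Proof.
have t_gt0 := t0; have t_lt1 := t1.
case: s => p z; cbv zeta; set y := agd_extrapolate t _.
set e := L *: _ - _ - _; rewrite /lyapunov /=.
set q := z - xs; set w := p + t^-1 *: (x - p) - xs.
pose M := L + mu; have M0 : 0 < M by rewrite addr_gt0.
have muE : mu = t ^+ 2 * M.
  by rewrite /t sqr_agd_rate // divfK // gt_eqF.
have tp : 1 + t != 0 by rewrite gt_eqF //; lra.
have tn : t != 0 by rewrite gt_eqF.
have LE : L = (1 - t ^+ 2) * M by rewrite mulrBl -muE /M; ring.
pose v := y - xs.
have pE : p - xs = (1 + t) *: v - t *: q.
  by rewrite /v /y /q /agd_extrapolate /=; row_field.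
have xE : x - p = t *: (w - (p - xs)) by rewrite /w; row_field.
have xsE : x - xs = (1 - t) *: (p - xs) + t *: w.
  by rewrite (_ : x - xs = (x - p) + (p - xs)); [rewrite xE; row_ring|row_ring].
have yE : x - y = (x - xs) - v by rewrite /v; row_ring.
have gE : gQ x = - (L *: (x - y)) - gP y - e by rewrite /e; row_ring.
have I1 := P_descent p y x; have I2 := P_descent xs y x.
have := Q_cvx x p; have := Q_cvx x xs.
have -> : p - x = - (x - p) by row_ring.
have -> : xs - x = - (x - xs) by row_ring.
rewrite gE => J2 J1.
have ct : 0 <= 1 - t by lra.
(* The inequalities against the previous iterate get weight [1 - t], those against the solution
   weight [t], so that [x] minus the weighted point is [t *: w]. *)
have := ler_wpM2l ct (lerD I1 J1); have := ler_wpM2l (ltW t0) (lerD I2 J2).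
(* Once [mu] and [L] are written through [t] and [M], this term is exactly the slack of the
   claim. *)
have N : 0 <= t ^+ 3 * ((1 - t) * (1 + t) * M) / 2 * dot (v - q) (v - q).
  rewrite mulr_ge0 ?dot_ge0 // divr_ge0 // mulr_ge0 ?exprn_ge0 ?ltW //.
  by rewrite !mulr_gt0 //; lra.
move: N; rewrite yE xE xsE pE muE LE.
clear xE xsE yE gE I1 I2 J1 J2 pE LE muE.
move: (gP y) e v q w (P x) (P p) (P xs) (Q x) (Q p) (Q xs) => a e' v' q' w'.
move=> Px Pp Ps Qx Qp Qs.
by dot_expand; lra.
Qed.

Lemma agd_step_error (th r : R) s x :
  0 <= th <= mu / 8 -> 0 <= r ->
  let y := agd_extrapolate t s in
  norm2 (L *: (y - x) - gP y - gQ x) <= th * (norm2 (y - xs) + r) ->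
  lyapunov (agd_update t s x) <=
    (1 - t / 4) * lyapunov s + t * (4 * th ^+ 2 * r ^+ 2 / mu).
Proof.
move=> /andP[th0 th1] r0; cbv zeta; set y := agd_extrapolate t s.
set e := L *: _ - _ - _ => He; have t_gt0 := t0; have t_lt1 := t1.
have := agd_step s x; rewrite -/y -/e /=.
have := lyapunov_ge (agd_update t s x); have := lyapunov_ge s.
set s' := agd_update t s x; set w := s'.2 - xs; set V0 := lyapunov s.
set V1 := lyapunov s' => G0 G1 H.

have Y : dot (y - xs) (y - xs) <=
    dot (s.1 - xs) (s.1 - xs) + dot (s.2 - xs) (s.2 - xs).
  have -> : y - xs = (1 + t)^-1 *: ((s.1 - xs) + t *: (s.2 - xs)).
    have tp : 1 + t != 0 by rewrite gt_eqF // addr_gt0.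
    by rewrite /y /agd_extrapolate; row_field.
  move: (s.1 - xs) (s.2 - xs) => a b.
  rewrite dotZl dotZr mulrA -expr2 exprVn ler_pdivrMl ?exprn_gt0 ?addr_gt0 //.
  have := mulr_ge0 (ltW t_gt0) (dot_ge0 (a - b)); have := dot_ge0 b.
  have := mulr_ge0 (ltW t_gt0) (dot_ge0 a); have := mulr_ge0 (ltW t_gt0) (dot_ge0 b).
  have := mulr_ge0 (ltW t_gt0) (mulr_ge0 (ltW t_gt0) (dot_ge0 a)).
  by dot_expand; lra.
have eB : dot e e <= 2 * th ^+ 2 * (2 / mu * V0 + r ^+ 2).
  move: He; rewrite norm2_leP; last by rewrite mulr_ge0 ?addr_ge0 ?norm2_ge0.
  move=> /le_trans; apply.
  rewrite exprMn [2 * th ^+ 2]mulrC -[_ * 2 * _]mulrA ler_wpM2l ?sqr_ge0 //.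
  apply: (@le_trans _ _ (2 * (norm2 (y - xs) ^+ 2 + r ^+ 2))).
    by have := sqr_ge0 (norm2 (y - xs) - r); lra.
  rewrite ler_pM2l // lerD2r sqr_norm2 (le_trans Y) //.
  by rewrite mulrAC ler_pdivlMr // mulrC; lra.
have eC : dot e e / mu <= V0 / 16 + 2 * th ^+ 2 * r ^+ 2 / mu.
  have V0p : 0 <= V0.
    apply: le_trans G0; rewrite mulr_ge0 ?addr_ge0 ?dot_ge0 //.
    by rewrite divr_ge0 // ltW.
  (* The bound [th <= mu / 8] makes the coefficient [4 * th ^+ 2 / mu ^+ 2] of [V0] at most
     [1 / 16]. *)
  have tt : th ^+ 2 <= mu ^+ 2 / 64 by nra.
  have T : 2 * th ^+ 2 * (2 / mu * V0) <= V0 / 16 * mu.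
    rewrite [leLHS](_ : _ = (4 / mu * V0) * th ^+ 2); last by ring.
    apply: le_trans (ler_wpM2l _ tt) _.
      by rewrite mulr_ge0 // divr_ge0 // ltW.
    by rewrite le_eqVlt; apply/orP; left; apply/eqP; field; rewrite gt_eqF.
  rewrite ler_pdivrMr // (le_trans eB) // [leRHS]mulrDl divfK ?gt_eqF //.
  by rewrite [leLHS]mulrDr lerD2r.
have eD := dot_young e w mu_gt0.
have := dot_ge0 (s'.1 - xs); move: G1; rewrite -/w => G1 D0.
have W : mu / 4 * dot w w <= V1 / 2.
  by have := mulr_ge0 (ltW mu_gt0) D0; lra.
set K := 2 * th ^+ 2 * r ^+ 2 / mu in eC *.
rewrite (_ : 4 * th ^+ 2 * r ^+ 2 / mu = 2 * K); last by rewrite /K; ring.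
have K0 : 0 <= K by rewrite !mulr_ge0 ?sqr_ge0 // invr_ge0 ltW.
have V0p : 0 <= V0.
  apply: le_trans G0; rewrite mulr_ge0 ?addr_ge0 ?dot_ge0 //.
  by rewrite divr_ge0 // ltW.
(* Young's inequality charges [t / 2 * V1] to the new state, and it is moved to the left. Since [1 -
   t + t / 16 <= (1 - t / 2) * (1 - t / 4)], a contraction by [1 - t / 4] survives, at the cost of
   doubling [K]. *)
have X : (1 - t / 2) * V1 <= (1 - t + t / 16) * V0 + t * K.
  have : t * - dot e w <= t * (V0 / 16 + K + V1 / 2).
    by rewrite ler_pM2l //; lra.
  by lra.
have c : 0 < 1 - t / 2 by lra.
rewrite -(ler_pM2l c) (le_trans X) //.
have := mulr_ge0 (mulr_ge0 (ltW t_gt0) V0p) (ltW t_gt0).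
have := mulr_ge0 (mulr_ge0 (ltW t_gt0) K0) (_ : 0 <= 1 - t).
have := mulr_ge0 (ltW t_gt0) V0p.
by lra.
Qed.

(** The errors [t * D] of the steps add up to at most [4 * D] against the contraction [1 - t / 4],
    whatever the number of steps. The conclusion has the same shape as the hypothesis on [prox],
    distance plus radius, which is what allows nesting. *)
Lemma agd_error (th r rho LPhi Lam : R) (prox : V -> V) x0 :
  0 <= th <= mu / 8 -> 0 <= r -> 0 <= rho -> 0 <= Lam ->
  (forall y, norm2 (L *: (y - prox y) - gP y - gQ (prox y)) <=
     th * (norm2 (y - xs) + r)) ->
  lip LPhi (fun x => gP x + gQ x) ->
  expR (- Lam) * (2 * LPhi + mu) <= rho ^+ 2 * mu -> 6 * th <= rho * mu ->
  norm2 (agd L mu Lam prox x0 - xs) <= rho * (norm2 (x0 - xs) + r).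
Proof.
move=> th01 r0 rho0 Lam0 Hp lPhi HE Hth; have t_gt0 := t0; have t_lt1 := t1.
set D := 4 * th ^+ 2 * r ^+ 2 / mu.
have D0 : 0 <= D.
  by apply: divr_ge0; [rewrite 2?mulr_ge0 ?sqr_ge0|exact: ltW].
pose st k := iter k (fun s => agd_update t s (prox (agd_extrapolate t s))) (x0, x0).
have It k : lyapunov (st k) <= (1 - t / 4) ^+ k * lyapunov (x0, x0) + 4 * D.
  elim: k => [|k IH]; first by rewrite expr0 mul1r lerDl mulr_ge0.
  have := agd_step_error th01 r0 (Hp (agd_extrapolate t (st k))).
  rewrite -/D => /le_trans; apply.
  have c : 0 <= 1 - t / 4 by lra.
  have := ler_wpM2l c IH; rewrite exprS; lra.
have V0 : lyapunov (x0, x0) <= (LPhi + mu / 2) * dot (x0 - xs) (x0 - xs).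
  rewrite /lyapunov /= mulrDl lerD2r.
  have cPQ : cvx_grad 0 (fun x => P x + Q x) (fun x => gP x + gQ x).
    by apply: cvx_gradW (cvx_gradD P_cvx Q_cvx); rewrite add0r ltW.
  exact: (cvx_grad_gap _ cPQ lPhi xs_opt).
have V0p : 0 <= lyapunov (x0, x0).
  apply: le_trans (lyapunov_ge _); rewrite mulr_ge0 ?addr_ge0 ?dot_ge0 //.
  by rewrite divr_ge0 // ltW.
have {}It := It (agd_steps Lam t); have := lyapunov_ge (st (agd_steps Lam t)).
rewrite /agd -/t -/(st _); set x := st _ in It * => G.
have E : (1 - t / 4) ^+ agd_steps Lam t <= expR (- Lam).
  by apply: agd_steps_exp; rewrite ?t_gt0.
rewrite norm2_leP; last by rewrite mulr_ge0 ?addr_ge0 ?norm2_ge0.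
rewrite exprMn.
apply: (@le_trans _ _ (rho ^+ 2 * (dot (x0 - xs) (x0 - xs) + r ^+ 2))); last first.
  rewrite ler_wpM2l ?sqr_ge0 // -sqr_norm2.
  by have := mulr_ge0 (norm2_ge0 (x0 - xs)) r0; lra.
set d := dot (x0 - xs) _ in V0 *.
have d0 : 0 <= d by exact: dot_ge0.
have A1 : (1 - t / 4) ^+ agd_steps Lam t * lyapunov (x0, x0) <= rho ^+ 2 * (mu / 2) * d.
  apply: le_trans (ler_wpM2r V0p E) _; apply: le_trans (ler_wpM2l (expR_ge0 _) V0) _.
  by rewrite [leLHS]mulrA ler_wpM2r //; lra.
(* This amounts to [32 * th ^+ 2 <= (rho * mu) ^+ 2], whence the factor 6 in the hypothesis on
   [th]. *)
have A2 : 4 * D <= rho ^+ 2 * (mu / 2) * r ^+ 2.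
  rewrite /D -(ler_pM2r mu_gt0) (_ : _ * mu = 16 * th ^+ 2 * r ^+ 2); last first.
    by field; rewrite gt_eqF.
  rewrite (_ : _ * mu = (rho * mu) ^+ 2 / 2 * r ^+ 2); last by field.
  rewrite ler_wpM2r ?sqr_ge0 //.
  case/andP: th01 => th0 _.
  have : (6 * th) ^+ 2 <= (rho * mu) ^+ 2.
    by apply: lerXn2r; rewrite ?nnegrE ?mulr_ge0 // ltW.
  by have := sqr_ge0 th; lra.
have m2 : 0 < mu / 2 by rewrite divr_gt0.
rewrite -(ler_pM2l m2).
have := mulr_ge0 (ltW m2) (dot_ge0 (x.2 - xs)).
lra.
Qed.

End Analysis.
End AGD.

(** * Oracle programs *)

Section Programs.
Context {R : realType} {dx dy m : nat}.
Local Notation query := (query R dx dy m).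
Local Notation oracle := (oracle R dx dy m).

(** An [algorithm] outputs a point of the [y] space only; a free monad over the queries lets
    subroutines return any type and be composed. *)
Inductive prog (T : Type) : Type :=
| Ret of T
| Request (q : query) of (answer q -> prog T).

Fixpoint bind (S T : Type) (p : prog S) (k : S -> prog T) : prog T :=
  match p with
  | Ret s => k s
  | Request q c => Request (fun a => bind (c a) k)
  end.

Fixpoint eval (T : Type) (o : oracle) (p : prog T) : T :=
  match p with
  | Ret x => x
  | Request q c => eval o (c (o q))
  end.

Fixpoint cost (T : Type) (P : pred query) (o : oracle) (p : prog T) : nat :=
  match p with
  | Ret _ => 0
  | Request q c => (P q + cost P o (c (o q)))%N
  end.

Fixpoint to_algorithm (p : prog 'rV[R]_dy) : algorithm R dx dy m :=
  match p with
  | Ret y => Output _ _ y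
  | Request q c => Ask (fun a => to_algorithm (c a))
  end.

Definition ask (q : query) : prog (answer q) := Request (fun a => Ret a).

Lemma output_to_algorithm o p : output o (to_algorithm p) = eval o p.
Proof. by elim: p => //= q c IH; rewrite IH. Qed.

Lemma calls_to_algorithm P o p : calls P o (to_algorithm p) = cost P o p.
Proof. by elim: p => //= q c IH; rewrite IH. Qed.

Lemma eval_bind (S T : Type) o (p : prog S) (k : S -> prog T) :
  eval o (bind p k) = eval o (k (eval o p)).
Proof. by elim: p => //= q c IH; rewrite IH. Qed.

Lemma cost_bind (S T : Type) P o (p : prog S) (k : S -> prog T) :
  cost P o (bind p k) = (cost P o p + cost P o (k (eval o p)))%N.
Proof. by elim: p => //= q c IH; rewrite IH addnA. Qed.

Fixpoint iterM (S : Type) (N : nat) (body : S -> prog S) (s : S) : prog S :=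
  if N is k.+1 then bind (iterM k body s) body else Ret s.

Lemma eval_iterM (S : Type) o N (body : S -> prog S) s :
  eval o (iterM N body s) = iter N (fun s => eval o (body s)) s.
Proof. by elim: N => //= N IH; rewrite eval_bind IH. Qed.

Lemma cost_iterM (S : Type) P o N (body : S -> prog S) s c :
  (forall s, cost P o (body s) <= c)%N -> (cost P o (iterM N body s) <= N * c)%N.
Proof.
by move=> H; elim: N => //= N IH; rewrite cost_bind mulSn addnC leq_add.
Qed.

Definition averageM (T : lmodType R) (p : 'I_m -> prog T) : prog T :=
  bind (foldr (fun i acc => bind (p i) (fun g => bind acc (fun s => Ret (g + s))))
         (Ret 0) (enum 'I_m))
    (fun s => Ret (m%:R^-1 *: s)).

Lemma eval_averageM (T : lmodType R) o (p : 'I_m -> prog T) :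
  eval o (averageM p) = m%:R^-1 *: \sum_(i < m) eval o (p i).
Proof.
rewrite eval_bind /=; congr (_ *: _); rewrite -big_enum /=.
elim: (enum _) => [|i s IH] /=; first by rewrite big_nil.
by rewrite eval_bind eval_bind /= IH big_cons.
Qed.

Lemma cost_averageM (T : lmodType R) P o (p : 'I_m -> prog T) c :
  (forall i, cost P o (p i) = c) -> cost P o (averageM p) = (m * c)%N.
Proof.
move=> H; rewrite cost_bind /= addn0 -[in RHS](size_enum_ord m).
by elim: (enum _) => //= i s IH; rewrite cost_bind cost_bind /= IH H addn0 mulSn.
Qed.

Definition agdM (n : nat) (L mu Lam : R) (prox : 'rV[R]_n -> prog 'rV[R]_n)
    (x : 'rV[R]_n) : prog 'rV[R]_n :=
  let t := agd_rate L mu in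
  bind (iterM (agd_steps Lam t)
         (fun s => bind (prox (agd_extrapolate t s))
                     (fun x' => Ret (agd_update t s x'))) (x, x))
    (fun s => Ret s.1).

Lemma eval_agdM n L mu Lam (prox : 'rV[R]_n -> prog 'rV[R]_n) x o :
  eval o (agdM L mu Lam prox x) = agd L mu Lam (fun y => eval o (prox y)) x.
Proof.
rewrite eval_bind eval_iterM /agd; move: (agd_steps _ _) => N /=.
by congr (fst (iter _ _ _)); apply/funext => s; rewrite eval_bind.
Qed.

Lemma cost_agdM n L mu Lam (prox : 'rV[R]_n -> prog 'rV[R]_n) x P o c :
  (forall y, cost P o (prox y) <= c)%N ->
  (cost P o (agdM L mu Lam prox x) <= agd_steps Lam (agd_rate L mu) * c)%N.
Proof.
move=> H; rewrite cost_bind addn0; apply: cost_iterM => s.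
by rewrite cost_bind addn0.
Qed.

(* An accelerated step linearizes [P] only, the smoother function; its subproblem
   is solved by the same method, with the quadratic term as composite part. *)
Definition slidingM (n : nat) (mu Lp Lq Lam : R)
    (phat qhat : 'rV[R]_n -> prog 'rV[R]_n) : 'rV[R]_n -> prog 'rV[R]_n :=
  agdM (2 * Lp) mu Lam (fun y => bind (phat y) (fun c =>
    agdM (2 * Lq) (2 * Lp) Lam (fun v => bind (qhat v) (fun q =>
      Ret ((2 * Lq + 2 * Lp)^-1 *:
             (2 * Lq *: v + 2 * Lp *: y - q - c)))) y)).

Lemma cost_slidingM n mu Lp Lq Lam (phat qhat : 'rV[R]_n -> prog 'rV[R]_n)
    x P o cp cq :
  (forall y, cost P o (phat y) <= cp)%N -> (forall y, cost P o (qhat y) <= cq)%N ->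
  (cost P o (slidingM mu Lp Lq Lam phat qhat x) <=
     agd_steps Lam (agd_rate (2 * Lp) mu) *
       (cp + agd_steps Lam (agd_rate (2 * Lq) (2 * Lp)) * cq))%N.
Proof.
move=> Hp Hq; apply: cost_agdM => y; rewrite cost_bind leq_add //.
by apply: cost_agdM => v; rewrite cost_bind addn0.
Qed.

Lemma cvx_grad_quad n (c a : 'rV[R]_n) (k : R) :
  cvx_grad k (fun u => dot c u + k / 2 * dot (u - a) (u - a))
    (fun u => c + k *: (u - a)).
Proof.
move=> x u; rewrite le_eqVlt; apply/orP; left; apply/eqP; rewrite /=.
by dot_expand; field.
Qed.

Section Sliding.
Variables (n : nat) (mu Lp Lq Lam th r rho rhoC : R) (o : oracle).
Variables (P Q : 'rV[R]_n -> R) (gP gQ : 'rV[R]_n -> 'rV[R]_n) (xs : 'rV[R]_n).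
Variables phat qhat : 'rV[R]_n -> prog 'rV[R]_n.
Hypotheses (mu_gt0 : 0 < mu) (mu_Lp : mu <= Lp) (Lp_Lq : Lp <= Lq).
Hypotheses (P_cvx : cvx_grad 0 P gP) (P_lip : lip Lp gP).
Hypotheses (Q_cvx : cvx_grad mu Q gQ) (Q_lip : lip Lq gQ).
Hypothesis xs_opt : gP xs + gQ xs = 0.
Hypotheses (th_ge0 : 0 <= th) (r_ge0 : 0 <= r) (Lam_ge0 : 0 <= Lam).
Hypothesis phatP : forall x,
  norm2 (eval o (phat x) - gP x) <= th * (norm2 (x - xs) + r).
Hypothesis qhatP : forall x,
  norm2 (eval o (qhat x) - gQ x) <= th * (norm2 (x - xs) + r).
Hypotheses (rho_gt0 : 0 < rho) (rho_half : rho <= 1 / 2) (rhoC_gt0 : 0 < rhoC).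
Hypotheses (rhoC_le : 180 * Lq * rhoC <= rho * mu) (th_le : 12 * th <= rho * mu).
Hypothesis thC_le : 3 * th <= rhoC * Lp.
Hypothesis Lam_inner : expR (- Lam) * (8 * Lq) <= rhoC ^+ 2 * (2 * Lp).
Hypothesis Lam_outer : expR (- Lam) * (5 * Lq) <= rho ^+ 2 * mu.

Lemma sliding_error x0 :
  norm2 (eval o (slidingM mu Lp Lq Lam phat qhat x0) - xs) <=
    rho * (norm2 (x0 - xs) + r).
Proof.
have [[[mu0 muLp] LpLq] th0] := (mu_gt0, mu_Lp, Lp_Lq, th_ge0).
have [[[rhoh rhoC1] th1] thC1] := (rho_half, rhoC_le, th_le, thC_le).
have [r0 rhoC0] := (r_ge0, rhoC_gt0).
have Lp0 : 0 < Lp by apply: lt_le_trans mu_Lp.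
have Lq0 : 0 < Lq by apply: lt_le_trans Lp_Lq.
have thmu : 24 * th <= mu.
  have : rho * mu <= 1 / 2 * mu by rewrite ler_pM2r.
  by lra.
rewrite eval_agdM; set prox := fun y => _.
have Lp20 : 0 < 2 * Lp by rewrite mulr_gt0.
have Lq20 : 0 < 2 * Lq by rewrite mulr_gt0.
(* The inner inexactness [5 * rhoC] is multiplied by [2 * Lp + Lq <= 3 * Lq], and the gradient error
   [th] is added. The constants 180 and 12 give each summand half of the budget
   [6 * thB <= rho * mu]. *)
pose thB := 15 * Lq * rhoC + th.
have thB0 : 0 <= thB by rewrite addr_ge0 // !mulr_ge0 // ltW.
have thBmu : 6 * thB <= rho * mu by rewrite /thB; lra.
have thB8 : thB <= mu / 8.
  have : rho * mu <= 1 / 2 * mu by rewrite ler_pM2r.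
  by lra.
apply: (@agd_error _ _ _ _ P Q gP gQ xs _ _ _ _ _ _ thB r rho (Lp + Lq)) => //.
- exact: lip_descent.
- by rewrite thB0.
- exact: ltW.
- move=> y; rewrite /prox eval_bind; set c := eval o (phat y).
  set d := norm2 (y - xs); have d0 : 0 <= d by exact: norm2_ge0.
  pose gC u := c + 2 * Lp *: (u - y).
  have gC_cvx : cvx_grad (2 * Lp) _ gC := cvx_grad_quad c y (2 * Lp).
  have gC_lip : lip (2 * Lp) gC.
    move=> u v; rewrite /gC (_ : _ - _ = 2 * Lp *: (u - v)); last by row_ring.
    by rewrite norm2Z gtr0_norm.
  have Q_cvx0 : cvx_grad 0 Q gQ by apply: cvx_gradW Q_cvx; exact: ltW.
  have [us us_opt] : exists us, gQ us + gC us = 0.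
    apply: (@monotone_zero _ _ (2 * Lp) (Lq + 2 * Lp)) => //; last exact: lipD.
    apply: cvx_grad_monotone; rewrite -[2 * Lp]add0r.
    exact: (cvx_gradD Q_cvx0 gC_cvx).
  have cP : norm2 (c - gP y) <= th * (d + r) by exact: phatP.
  (* The subproblem map with [c] removed is [2 * Lp]-strongly monotone; its values at [us] and [xs]
     differ only by a shift of the center, the gradient error and a variation of [gP]. *)
  have usB : norm2 (us - xs) <= 2 * d + r.
    have mQ : monotone (2 * Lp) (fun u => gQ u + 2 * Lp *: (u - y)).
      apply: cvx_grad_monotone; rewrite -[X in cvx_grad X]add0r.
      have := cvx_grad_quad 0 y (2 * Lp) => q.
      apply: (cvx_gradD Q_cvx0
        (G := fun u => dot 0 u + 2 * Lp / 2 * dot (u - y) (u - y))) => x u.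
      by have := q x u; rewrite add0r.
    have := @monotone_norm _ _ _ _ us xs mQ.
    have -> : gQ us + 2 * Lp *: (us - y) - (gQ xs + 2 * Lp *: (xs - y)) =
        2 * Lp *: (y - xs) - ((c - gP y) + (gP y - gP xs)).
      have -> : gQ xs = - gP xs by apply/eqP; rewrite -addr_eq0 addrC xs_opt.
      have -> : gQ us = - gC us by apply/eqP; rewrite -addr_eq0 us_opt.
      by rewrite /gC; row_ring.
    move=> H; have := P_lip y xs; rewrite -/d => PL.
    have := norm2D (c - gP y) (gP y - gP xs).
    have := norm2D (2 * Lp *: (y - xs)) (- ((c - gP y) + (gP y - gP xs))).
    rewrite norm2N norm2Z (gtr0_norm Lp20) -/d => N1 N2.
    have : 2 * Lp * norm2 (us - xs) <= 2 * Lp * (2 * d + r).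
      have : th * (d + r) <= Lp * (d + r).
        by rewrite ler_wpM2r ?addr_ge0 //; lra.
      have := mulr_ge0 (ltW Lp0) r_ge0.
      by lra.
    by rewrite ler_pM2l.
  rewrite eval_agdM; set ut := agd _ _ _ _ _.
  have utB : norm2 (ut - us) <= 5 * rhoC * (d + r).
    (* The errors of [qhat] are relative to [xs], whereas the inner loop converges to [us]; the
       distance between them is added to the radius. *)
    apply: (@le_trans _ _ (rhoC * (norm2 (y - us) + (norm2 (us - xs) + r)))).
      apply: (@agd_error _ _ _ _ Q _ gQ gC us _ _ _ _ gC_cvx _ th _ rhoC
        (Lq + 2 * Lp)) => //.
      + exact: lip_descent.
      + by rewrite th_ge0 /=; lra.
      + by rewrite addr_ge0 ?norm2_ge0.
      + exact: ltW.
      + move=> v; rewrite eval_bind /=; set w := _^-1 *: _.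
        (* [w] solves the linearized subproblem in closed form, so the residual is the error of
           [qhat] alone. *)
        rewrite (_ : _ - gC w = eval o (qhat v) - gQ v); last first.
          rewrite /gC /w; row_field.
          by rewrite gt_eqF // addr_gt0.
        apply: le_trans (qhatP v) _; rewrite ler_wpM2l // addrA lerD2r.
        exact: norm2_tri.
      + exact: lipD.
      + by apply: le_trans Lam_inner; rewrite ler_wpM2l ?expR_ge0 //; lra.
      + by lra.
    rewrite [leRHS](_ : _ = rhoC * (5 * d + 5 * r)); last by ring.
    rewrite ler_pM2l //; have := norm2_tri xs y us; rewrite -/d (norm2B xs us).
    by lra.
  rewrite (_ : _ - gQ ut =
    2 * Lp *: (us - ut) + ((c - gP y) - (gQ ut - gQ us))); last first.
    have -> : gQ us = - gC us by apply/eqP; rewrite -addr_eq0 us_opt.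
    by rewrite /gC; row_ring.
  apply: le_trans (norm2D _ _) _; rewrite norm2Z gtr0_norm // norm2B.
  apply: le_trans (lerD (lexx _) (norm2D _ _)) _; rewrite norm2N.
  have := Q_lip ut us => QL.
  have K : (2 * Lp + Lq) * norm2 (ut - us) <= 3 * Lq * (5 * rhoC * (d + r)).
    by apply: ler_pM; [lra|exact: norm2_ge0|lra|exact: utB].
  by rewrite /thB; lra.
- exact: lipD.
- by apply: le_trans Lam_outer; rewrite ler_wpM2l ?expR_ge0 //; lra.
Qed.

End Sliding.

End Programs.

(** * Saddle-point problems *)

(** The gradient maps are data, so that averages of oracle answers can be plugged in directly, and
    the joint smoothness of [G] is split into Lipschitz bounds in each variable. *)
Record saddle_problem {R : realType} {dx dy : nat} (mux muy Lf Lh LG : R)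
    (f : 'rV[R]_dx -> R) (gf : 'rV[R]_dx -> 'rV[R]_dx)
    (h : 'rV[R]_dy -> R) (gh : 'rV[R]_dy -> 'rV[R]_dy)
    (G : 'rV[R]_dx -> 'rV[R]_dy -> R)
    (Gx : 'rV[R]_dx -> 'rV[R]_dy -> 'rV[R]_dx)
    (Gy : 'rV[R]_dx -> 'rV[R]_dy -> 'rV[R]_dy) : Prop := SaddleProblem {
  sp_mux : 0 < mux;
  sp_muy : 0 < muy;
  sp_mux_Lf : mux <= Lf;
  sp_mux_LG : mux <= LG;
  sp_muy_LG : muy <= LG;
  sp_Lh : 0 <= Lh;
  sp_f : cvx_grad mux f gf;
  sp_f_lip : lip Lf gf;
  sp_h : cvx_grad muy h gh;
  sp_h_lip : lip Lh gh;
  sp_Gx : forall y, cvx_grad 0 (G^~ y) (Gx^~ y);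
  sp_Gy : forall x, cvx_grad 0 (fun y => - G x y) (fun y => - Gy x y);
  sp_Gx_lipx : forall y, lip LG (Gx^~ y);
  sp_Gx_lipy : forall x, lip LG (Gx x);
  sp_Gy_lipx : forall y, lip LG (Gy^~ y);
  sp_Gy_lipy : forall x, lip LG (Gy x)
}.

Section Saddle.
Context {R : realType} {dx dy : nat}.
Variables (mux muy Lf Lh LG : R).
Variables (f : 'rV[R]_dx -> R) (gf : 'rV[R]_dx -> 'rV[R]_dx).
Variables (h : 'rV[R]_dy -> R) (gh : 'rV[R]_dy -> 'rV[R]_dy).
Variables (G : 'rV[R]_dx -> 'rV[R]_dy -> R).
Variables (Gx : 'rV[R]_dx -> 'rV[R]_dy -> 'rV[R]_dx).
Variables (Gy : 'rV[R]_dx -> 'rV[R]_dy -> 'rV[R]_dy).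
Hypothesis S : saddle_problem mux muy Lf Lh LG f gf h gh G Gx Gy.

Let mux0 : 0 < mux := sp_mux S.
Let muy0 : 0 < muy := sp_muy S.
Let LG0 : 0 < LG. Proof. exact: lt_le_trans (sp_mux S) (sp_mux_LG S). Qed.
Let Lf0 : 0 < Lf. Proof. exact: lt_le_trans (sp_mux S) (sp_mux_Lf S). Qed.

(** Convexity in [x] and concavity in [y], each used at both ends, make the values of [G] cancel;
    the moduli come from [f] and [h]. *)
Lemma saddle_operator_monotone x y x' y' :
  mux * dot (x - x') (x - x') + muy * dot (y - y') (y - y') <=
  dot (gf x + Gx x y - (gf x' + Gx x' y')) (x - x') +
  dot (gh y - Gy x y - (gh y' - Gy x' y')) (y - y').
Proof.
have := cvx_grad_monotone (sp_f S) x x'.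
have := cvx_grad_monotone (sp_h S) y y'.
have := sp_Gx S y x x'; have := sp_Gx S y' x' x.
have := sp_Gy S x y y'; have := sp_Gy S x' y' y.
have -> : x' - x = - (x - x') by row_ring.
have -> : y' - y = - (y - y') by row_ring.
have -> : gf x + Gx x y - (gf x' + Gx x' y') =
  (gf x - gf x') + (Gx x y - Gx x' y') by row_ring.
have -> : gh y - Gy x y - (gh y' - Gy x' y') =
  (gh y - gh y') - (Gy x y - Gy x' y') by row_ring.
move: (x - x') (y - y') (gf x - gf x') (gh y - gh y') => a b c d.
by rewrite !mul0r !addr0 !(dotDl, dotNl, dotNr, opprK, dotDr); lra.
Qed.

(** The operator on concatenated vectors is Lipschitz and strongly monotone with modulus the smaller
    of [mux] and [muy]; its zero is the saddle point, without any compactness argument. *)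
Lemma exists_saddle : exists xs ys, gf xs + Gx xs ys = 0 /\ gh ys - Gy xs ys = 0.
Proof.
pose F (z : 'rV[R]_(dx + dy)) : 'rV[R]_(dx + dy) :=
  let x := lsubmx z in let y := rsubmx z in
  row_mx (gf x + Gx x y) (gh y - Gy x y).
have mF : monotone (Num.min mux muy) F.
  move=> z w.
  have := saddle_operator_monotone (lsubmx z) (rsubmx z) (lsubmx w) (rsubmx w).
  have E : z - w = row_mx (lsubmx z - lsubmx w) (rsubmx z - rsubmx w).
    by rewrite -add_row_mx -opp_row_mx !hsubmxK.
  rewrite E /F opp_row_mx add_row_mx !dot_row_mx.
  apply: le_trans; rewrite mulrDr lerD // ler_wpM2r ?dot_ge0 //.
    by rewrite ge_min lexx.
  by rewrite ge_min lexx orbT.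
have lF : lip (Lf + Lh + 4 * LG) F.
  move=> z w; rewrite /F opp_row_mx add_row_mx.
  apply: le_trans (norm2_row_mx _ _) _.
  set x := lsubmx z; set y := rsubmx z; set x' := lsubmx w; set y' := rsubmx w.
  have nx : norm2 (x - x') <= norm2 (z - w).
    by rewrite /x /x' -linearB; exact: norm2_lsubmx.
  have ny : norm2 (y - y') <= norm2 (z - w).
    by rewrite /y /y' -linearB; exact: norm2_rsubmx.
  rewrite (_ : gf x + Gx x y - _ =
    (gf x - gf x') + ((Gx x y - Gx x' y) + (Gx x' y - Gx x' y'))); last by row_ring.
  rewrite (_ : gh y - Gy x y - _ =
    (gh y - gh y') - ((Gy x y - Gy x' y) + (Gy x' y - Gy x' y'))); last by row_ring.
  have := norm2D (gf x - gf x') ((Gx x y - Gx x' y) + (Gx x' y - Gx x' y')).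
  have := norm2D (gh y - gh y') (- ((Gy x y - Gy x' y) + (Gy x' y - Gy x' y'))).
  rewrite norm2N.
  have := norm2D (Gx x y - Gx x' y) (Gx x' y - Gx x' y').
  have := norm2D (Gy x y - Gy x' y) (Gy x' y - Gy x' y').
  have := sp_f_lip S x x'; have := sp_h_lip S y y'.
  have := sp_Gx_lipx S y x x'; have := sp_Gx_lipy S x' y y'.
  have := sp_Gy_lipx S y x x'; have := sp_Gy_lipy S x' y y'.
  have := ler_wpM2l (ltW LG0) nx; have := ler_wpM2l (ltW LG0) ny.
  have := ler_wpM2l (ltW Lf0) nx; have := ler_wpM2l (sp_Lh S) ny.
  by lra.
have [|z Fz] := monotone_zero _ mF lF; first by rewrite lt_min mux0 muy0.
exists (lsubmx z), (rsubmx z); by apply/eq_row_mx; rewrite row_mx0.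
Qed.

Section Center.
Variable yb : 'rV[R]_dy.

Lemma prox_term_cvx x : cvx_grad (muy + LG)
  (fun y => - G x y + h y + LG / 2 * dot (y - yb) (y - yb))
  (fun y => - Gy x y + gh y + LG *: (y - yb)).
Proof.
rewrite -[muy]add0r; apply: cvx_gradD.
  by apply: (cvx_gradD (sp_Gy S x) (sp_h S)).
move=> y u; have := cvx_grad_quad 0 yb LG y u.
by rewrite /= !dot0l !add0r.
Qed.

Lemma prox_term_lip x : lip (LG + Lh + LG) (fun y => - Gy x y + gh y + LG *: (y - yb)).
Proof.
apply: lipD; last exact/lip_affine/ltW.
by apply: lipD (sp_h_lip S); apply: lipN; exact: sp_Gy_lipy S x.
Qed.

Lemma exists_response : exists yst : 'rV[R]_dx -> 'rV[R]_dy, forall x,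
  - Gy x (yst x) + gh (yst x) + LG *: (yst x - yb) = 0.
Proof.
have [F HF] : {F & forall x, - Gy x (F x) + gh (F x) + LG *: (F x - yb) = 0}.
  apply: (@choice _ _ (fun x y => - Gy x y + gh y + LG *: (y - yb) = 0)) => x.
  apply: monotone_zero (cvx_grad_monotone (prox_term_cvx x)) (prox_term_lip x).
  by rewrite addr_gt0.
by exists F.
Qed.

Variable yst : 'rV[R]_dx -> 'rV[R]_dy.
Hypothesis ystP : forall x, - Gy x (yst x) + gh (yst x) + LG *: (yst x - yb) = 0.

Lemma response_lip : lip 1 yst.
Proof.
move=> x x'; rewrite mul1r.
have := monotone_norm (yst x) (yst x') (cvx_grad_monotone (prox_term_cvx x)).
rewrite /= ystP sub0r norm2N.
have -> : - Gy x (yst x') + gh (yst x') + LG *: (yst x' - yb) =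
  - (Gy x (yst x') - Gy x' (yst x')).
  by rewrite -[RHS]addr0 -(ystP x'); row_ring.
rewrite norm2N => H; have := sp_Gy_lipx S (yst x') x x' => H2.
rewrite -(ler_pM2l LG0) (le_trans _ H2) // (le_trans _ H) //.
by rewrite ler_wpM2r ?norm2_ge0 // lerDr ltW.
Qed.

Definition primal x := G x (yst x) - h (yst x) - LG / 2 * dot (yst x - yb) (yst x - yb).

(** The envelope argument without differentiation: [primal u] is at least the regularized objective
    at [(u, yst x)], which is then linearized in [x]. *)
Lemma primal_cvx : cvx_grad 0 primal (fun x => Gx x (yst x)).
Proof.
move=> x u; have := prox_term_cvx u (yst u) (yst x); rewrite /= ystP dot0l addr0.
have := sp_Gx S (yst x) x u; rewrite /primal !mul0r !addr0 => H1 H2.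
have : 0 <= (muy + LG) / 2 * dot (yst x - yst u) (yst x - yst u).
  by rewrite mulr_ge0 ?dot_ge0 // divr_ge0 // addr_ge0 // ltW.
by lra.
Qed.

Lemma primal_lip : lip (2 * LG) (fun x => Gx x (yst x)).
Proof.
move=> x x'; apply: le_trans (norm2_tri (Gx x' (yst x)) _ _) _.
have := sp_Gx_lipx S (yst x) x x'; have := sp_Gx_lipy S x' (yst x) (yst x').
have := ler_wpM2l (ltW LG0) (response_lip x x'); rewrite mul1r.
by lra.
Qed.

Lemma exists_prox_primal : exists xh, gf xh + Gx xh (yst xh) = 0.
Proof.
apply: (@monotone_zero _ _ mux (Lf + 2 * LG)) => //.
  rewrite -[mux]addr0; apply: cvx_grad_monotone.
  exact: (cvx_gradD (sp_f S) primal_cvx).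
apply: lipD primal_lip; exact: sp_f_lip S.
Qed.

End Center.

Lemma exists_best_x : exists xst : 'rV[R]_dy -> 'rV[R]_dx, forall y,
  gf (xst y) + Gx (xst y) y = 0.
Proof.
have [F HF] : {F & forall y, gf (F y) + Gx (F y) y = 0}.
  apply: (@choice _ _ (fun y x => gf x + Gx x y = 0)) => y.
  apply: (@monotone_zero _ _ mux (Lf + LG)) => //.
    rewrite -[mux]addr0; apply: cvx_grad_monotone.
    exact: (cvx_gradD (sp_f S) (sp_Gx S y)).
  by apply: lipD; [exact: sp_f_lip S|exact: sp_Gx_lipx S y].
by exists F.
Qed.

Section Dual.
Variable xst : 'rV[R]_dy -> 'rV[R]_dx.
Hypothesis xstP : forall y, gf (xst y) + Gx (xst y) y = 0.

Lemma best_x_cvx y : cvx_grad mux (fun x => f x + G x y) (fun x => gf x + Gx x y).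
Proof. by rewrite -[mux]addr0; exact: (cvx_gradD (sp_f S) (sp_Gx S y)). Qed.

Lemma best_xP y x : f (xst y) + G (xst y) y <= f x + G x y.
Proof.
have := best_x_cvx y (xst y) x; rewrite /= xstP dot0l addr0; apply: le_trans.
by rewrite lerDl mulr_ge0 ?dot_ge0 // divr_ge0 // ltW.
Qed.

Lemma best_x_lip : lip (LG / mux) xst.
Proof.
move=> y y'; rewrite mulrAC ler_pdivlMr // mulrC.
have := monotone_norm (xst y) (xst y') (cvx_grad_monotone (best_x_cvx y)).
rewrite /= xstP sub0r norm2N => /le_trans; apply.
have -> : gf (xst y') + Gx (xst y') y = Gx (xst y') y - Gx (xst y') y'.
  by rewrite -[LHS]subr0 -(xstP y'); row_ring.
exact: sp_Gx_lipy S (xst y') y y'.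
Qed.

Definition dual y := h y - (f (xst y) + G (xst y) y).
Definition grad_dual y := gh y - Gy (xst y) y.

(** [xst u] minimizes, so [dual u] is at least the value with [xst y] kept in place; the strong
    convexity is that of [h]. *)
Lemma dual_cvx : cvx_grad muy dual grad_dual.
Proof.
move=> y u; have := best_xP u (xst y); rewrite /dual /grad_dual.
have := sp_h S y u; have := sp_Gy S (xst y) y u.
rewrite /= !mul0r !addr0 dotDl !dotNl.
move: (muy / 2 * _) => k; lra.
Qed.

(** The last term is the Lipschitz constant of [Gy] in [x] times that of [xst]. It affects the
    tolerances only, so the complexity sees it through a logarithm. *)
Definition lip_dual : R := Lh + LG + LG * (LG / mux).

Lemma dual_lip : lip lip_dual grad_dual.
Proof.
move=> y y'; rewrite /grad_dual.
rewrite (_ : gh y - _ - _ = (gh y - gh y') +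
  - ((Gy (xst y) y - Gy (xst y') y) + (Gy (xst y') y - Gy (xst y') y'))); last by row_ring.
apply: le_trans (norm2D _ _) _; rewrite norm2N.
apply: le_trans (lerD (lexx _) (norm2D _ _)) _.
have := sp_h_lip S y y'; have := sp_Gy_lipx S y (xst y) (xst y').
have := sp_Gy_lipy S (xst y') y y'.
have := ler_wpM2l (ltW LG0) (best_x_lip y y'); rewrite /lip_dual.
by rewrite mulrA; lra.
Qed.

End Dual.
End Saddle.

(** * The accelerated saddle-point algorithm *)

Section Algorithm.
Context {R : realType} {dx dy m : nat}.
Local Notation prog := (@prog R dx dy m).
Implicit Types (x : 'rV[R]_dx) (y yb : 'rV[R]_dy).

Definition gradGxM x y : prog 'rV[R]_dx :=
  averageM (fun i => ask (GradGx i x y)).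

Definition gradGyM x y : prog 'rV[R]_dy :=
  averageM (fun i => ask (GradGy i x y)).

Variables (mux muy Lf LG Lam : R) (c : {posnum R}).

(** The quadratics [LG / 2 * |. - yb| ^ 2] and [LG * |. - y| ^ 2] are merged into one of curvature
    [c = 3 * LG] centered at 0, with their centers moved to the linear term. One exact prox call
    thus solves the step. *)
Definition responseM x yb : prog 'rV[R]_dy :=
  agdM (2 * LG) LG Lam (fun y => bind (gradGyM x y) (fun g =>
    ask (Prox (- g - LG *: yb - 2 * LG *: y) 0 c))) yb.

Definition grad_primalM yb x : prog 'rV[R]_dx :=
  bind (responseM x yb) (gradGxM x).

(** The primal function is [2 * LG]-smooth, so the first case linearizes it. In the second, [f]
    minus its quadratic is still convex and [2 * Lf]-smooth, and the primal function receives the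
    strong convexity; its constant is rounded up to [4 * LG] so as to dominate [2 * Lf]. *)
Definition prox_primalM x0 yb : prog 'rV[R]_dx :=
  if 2 * LG <= Lf then
    slidingM mux (2 * LG) Lf Lam (grad_primalM yb) (fun x => ask (GradF x)) x0
  else
    slidingM mux (2 * Lf) (4 * LG) Lam
      (fun x => bind (ask (GradF x)) (fun g => Ret (g - mux *: x)))
      (fun x => bind (grad_primalM yb x) (fun g => Ret (g + mux *: x))) x0.

(** Every call restarts from the same [x0]; the distance from [x0] to the saddle point becomes the
    fixed radius of the outer loop. *)
Definition prox_dualM x0 yb : prog 'rV[R]_dy :=
  bind (prox_primalM x0 yb) (fun x => responseM x yb).

Definition saddleM x0 y0 : prog 'rV[R]_dy :=
  agdM LG muy Lam (prox_dualM x0) y0.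

Section Errors.
Variables (Lh : R) (o : oracle R dx dy m).
Variables (f : 'rV[R]_dx -> R) (h : 'rV[R]_dy -> R).
Variable G : 'rV[R]_dx -> 'rV[R]_dy -> R.
Let gf x : 'rV[R]_dx := o (GradF x).
Variable gh : 'rV[R]_dy -> 'rV[R]_dy.
Let Gx x y := eval o (gradGxM x y).
Let Gy x y := eval o (gradGyM x y).
Hypothesis S : saddle_problem mux muy Lf Lh LG f gf h gh G Gx Gy.
Hypothesis proxP : forall c1 yb (c2 : {posnum R}),
  c1 + gh (o (Prox c1 yb c2)) + c2%:num *: (o (Prox c1 yb c2) - yb) = 0.
Hypothesis cE : c%:num = 3 * LG.

Let mux0 : 0 < mux := sp_mux S.
Let muy0 : 0 < muy := sp_muy S.
Let LG0 : 0 < LG. Proof. exact: lt_le_trans (sp_mux S) (sp_mux_LG S). Qed.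
Let Lf0 : 0 < Lf. Proof. exact: lt_le_trans (sp_mux S) (sp_mux_Lf S). Qed.

(** Relative accuracies by layer: [rho] for the outer loop, [rhoB] for the primal minimization,
    [rhoC] for the inner sliding loop, [rhoD] for the response in [y]. *)
Variables rho rhoD rhoB rhoC Lm : R.
Hypotheses (Lam0 : 0 <= Lam) (rho0 : 0 < rho).
Hypotheses (rhoD0 : 0 < rhoD) (rhoD1 : rhoD <= 1) (rhoB0 : 0 < rhoB).
Hypotheses (rhoB_half : rhoB <= 1 / 2) (rhoC0 : 0 < rhoC).
Hypotheses (Lf_Lm : Lf <= Lm) (LG_Lm : 4 * LG <= Lm).
Hypothesis Lam_response : expR (- Lam) * (5 * LG + 2 * Lh) <= rhoD ^+ 2 * LG.
Hypothesis rhoC_le : 180 * Lm * rhoC <= rhoB * mux.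
Hypothesis rhoD_rhoB : 12 * (LG * rhoD) <= rhoB * mux.
Hypothesis rhoD_rhoC : 3 * (LG * rhoD) <= rhoC * mux.
Hypothesis Lam_inner : expR (- Lam) * (8 * Lm) <= rhoC ^+ 2 * (2 * mux).
Hypothesis Lam_outer : expR (- Lam) * (5 * Lm) <= rhoB ^+ 2 * mux.

Section Center.
Variables (yb : 'rV[R]_dy) (yst : 'rV[R]_dx -> 'rV[R]_dy).
Hypothesis ystP : forall x, - Gy x (yst x) + gh (yst x) + LG *: (yst x - yb) = 0.

Lemma response_error x :
  norm2 (eval o (responseM x yb) - yst x) <= rhoD * norm2 (yb - yst x).
Proof.
rewrite eval_agdM -[norm2 (yb - _)]addr0.
have LG20 : 0 < 2 * LG by rewrite mulr_gt0.
have c1 : cvx_grad LG (fun y => h y + LG / 2 * dot (y - yb) (y - yb))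
    (fun y => gh y + LG *: (y - yb)).
  rewrite -[LG in cvx_grad LG]add0r; apply: cvx_gradD.
    by apply: cvx_gradW (sp_h S); exact: ltW.
  by move=> y u; have := cvx_grad_quad 0 yb LG y u; rewrite /= !dot0l !add0r.
apply: (@agd_error _ _ _ _ (fun y => - G x y) _ (fun y => - Gy x y) _ (yst x)
  _ _ _ _ c1 _ 0 0 rhoD (LG + Lh + LG)) => //.
- exact (sp_Gy S x).
- by apply: lip_descent (sp_Gy S x) _; apply: lipN; exact: sp_Gy_lipy S x.
- by rewrite addrA ystP.
- by rewrite lexx divr_ge0 // ltW.
- exact: ltW.
- move=> y; rewrite mul0r eval_bind /=; set p := o _.
  rewrite (_ : _ - _ = 0) ?norm20 //.
  rewrite -[RHS]oppr0 -(proxP (- Gy x y - LG *: yb - 2 * LG *: y) 0 c) cE -/p.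
  by rewrite -/(Gy x y); row_ring.
- move=> u v; have := prox_term_lip S yb x u v.
  by rewrite !addrA.
- by apply: le_trans Lam_response; rewrite ler_wpM2l ?expR_ge0 //; lra.
- by rewrite mulr0 mulr_ge0 // ltW.
Qed.

Lemma prox_primal_error x0 xh : gf xh + Gx xh (yst xh) = 0 ->
  norm2 (eval o (prox_primalM x0 yb) - xh) <=
    rhoB * (norm2 (x0 - xh) + norm2 (yb - yst xh)).
Proof.
move=> xhP; set r := norm2 (yb - yst xh).
have [h1 h2] := (mux0, LG0); have h3 := Lf0; have h4 := sp_mux_LG S.
have h5 := sp_mux_Lf S.
have [[[k1 k2] k3] k4] := (rhoC_le, rhoD_rhoB, rhoD_rhoC, Lam_inner).
have [[k5 k6] k7] := (Lam_outer, Lf_Lm, LG_Lm).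
have r0 : 0 <= r by exact: norm2_ge0.
have th0 : 0 <= LG * rhoD by rewrite mulr_ge0 // ltW.
(* The response error is relative to [norm2 (yb - yst x)]. As [yst] is 1-Lipschitz, this is at most
   the distance from [x] to [xh] plus the fixed [r], the form that sliding accepts. *)
have gE x : norm2 (eval o (grad_primalM yb x) - Gx x (yst x)) <=
    LG * rhoD * (norm2 (x - xh) + r).
  rewrite eval_bind -/(Gx _ _); apply: le_trans (sp_Gx_lipy S x _ _) _.
  rewrite -mulrA ler_pM2l //; apply: le_trans (response_error x) _.
  rewrite ler_pM2l //; apply: le_trans (norm2_tri (yst xh) _ _) _.
  rewrite addrC lerD2r; apply: le_trans (response_lip S ystP _ _) _.
  by rewrite mul1r norm2B.
have e0 := expR_ge0 (- Lam).
have eL q : q <= Lm -> 180 * q * rhoC <= rhoB * mux.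
  by move=> qL; apply: le_trans k1; rewrite ler_pM2r //; lra.
have eL1 q p : q <= Lm -> mux <= p -> expR (- Lam) * (8 * q) <= rhoC ^+ 2 * (2 * p).
  move=> qL pL; apply: (@le_trans _ _ (expR (- Lam) * (8 * Lm))).
    by rewrite ler_wpM2l //; lra.
  by apply: le_trans k4 _; rewrite ler_wpM2l ?sqr_ge0 //; lra.
have eL2 q : q <= Lm -> expR (- Lam) * (5 * q) <= rhoB ^+ 2 * mux.
  by move=> qL; apply: le_trans k5; rewrite ler_wpM2l //; lra.
have eL3 p : mux <= p -> 3 * (LG * rhoD) <= rhoC * p.
  by move=> pL; apply: le_trans k3 _; rewrite ler_pM2l.
rewrite /prox_primalM; case: ifPn => [LL|].
  apply: (@sliding_error _ _ _ _ _ _ _ _ _ (LG * rhoD) _ _ rhoC o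
    (primal LG h G yb yst) f (fun x => Gx x (yst x)) gf).
  - by [].
  - lra.
  - by [].
  - exact (primal_cvx S ystP).
  - exact (primal_lip S ystP).
  - exact (sp_f S).
  - exact (sp_f_lip S).
  - by rewrite addrC.
  - by [].
  - by [].
  - by [].
  - exact: gE.
  - by move=> x; rewrite /= subrr norm20 mulr_ge0 // addr_ge0 // norm2_ge0.
  - by [].
  - by [].
  - by [].
  - exact: eL.
  - by [].
  - by apply: eL3; lra.
  - by apply: eL1 => //; lra.
  - by apply: eL2 => //; lra.
rewrite -ltNge => LL.
apply: (@sliding_error _ _ _ _ _ _ _ _ _ (LG * rhoD) _ _ rhoC o
    (fun x => f x + (- mux) / 2 * dot x x)
    (fun x => primal LG h G yb yst x + mux / 2 * dot x x)
    (fun x => gf x + (- mux) *: x) (fun x => Gx x (yst x) + mux *: x)).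
- by [].
- lra.
- lra.
- by rewrite -(subrr mux); exact: cvx_grad_shift (sp_f S).
- apply: (@lipW _ _ _ (Lf + `|- mux|)); first by rewrite normrN gtr0_norm //; lra.
  by apply: lipD (sp_f_lip S) _; exact: lip_scale.
- by rewrite -[X in cvx_grad X]add0r; exact: cvx_grad_shift (primal_cvx S ystP).
- apply: (@lipW _ _ _ (2 * LG + `|mux|)); first by rewrite gtr0_norm //; lra.
  by apply: lipD (primal_lip S ystP) _; exact: lip_scale.
- by rewrite -[RHS]xhP; row_ring.
- by [].
- by [].
- by [].
- by move=> x; rewrite /= scaleNr subrr norm20 mulr_ge0 // addr_ge0 // norm2_ge0.
- move=> x; rewrite eval_bind /=.
  rewrite (_ : _ - _ = eval o (grad_primalM yb x) - Gx x (yst x)); last by row_ring.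
  exact: gE.
- by [].
- by [].
- by [].
- exact: eL.
- by [].
- by apply: eL3; lra.
- by apply: eL1 => //; lra.
- by apply: eL2 => //; lra.
Qed.

End Center.

Let Lpsi := lip_dual mux Lh LG.

Hypothesis rho_outer :
  12 * (LG + Lpsi) * (rhoB + rhoD) * (2 + LG / mux) <= rho * muy.
Hypothesis rho_half : rho <= 1 / 2.
Hypothesis Lam_dual : expR (- Lam) * (2 * Lpsi + muy) <= rho ^+ 2 * muy.

Lemma saddle_error x0 y0 xs ys : gf xs + Gx xs ys = 0 -> gh ys - Gy xs ys = 0 ->
  norm2 (eval o (saddleM x0 y0) - ys) <= rho * (norm2 (y0 - ys) + norm2 (x0 - xs)).
Proof.
move=> xsP ysP; have [xst xstP] := exists_best_x S.
have [h1 h2] := (muy0, LG0).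
have xstys : xst ys = xs.
  apply/eqP; rewrite -subr_eq0; apply/eqP/norm2_eq0/eqP.
  have := monotone_norm (xst ys) xs (cvx_grad_monotone (best_x_cvx S ys)).
  rewrite /= xstP xsP subrr norm20 => H.
  by rewrite eq_le norm2_ge0 andbT -(pmulr_rle0 _ mux0).
set r := norm2 (x0 - xs); have r0 : 0 <= r by exact: norm2_ge0.
have Lpsi0 : 0 <= Lpsi.
  rewrite /Lpsi /lip_dual !addr_ge0 ?(sp_Lh S) ?mulr_ge0 //; try exact: ltW.
  by rewrite invr_ge0 ltW.
have Lk0 : 0 <= LG / mux by rewrite divr_ge0 // ltW.
pose th := 2 * (LG + Lpsi) * (rhoB + rhoD) * (2 + LG / mux).
have rBD : 0 <= rhoB + rhoD by rewrite addr_ge0 // ltW.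
have th0 : 0 <= th.
  rewrite /th mulr_ge0 //; last by rewrite addr_ge0.
  by rewrite mulr_ge0 // mulr_ge0 // addr_ge0 // ltW.
have th6 : 6 * th <= rho * muy by move: rho_outer; rewrite /th; lra.
rewrite eval_agdM.
(* With a zero smooth part, the composite method is the accelerated proximal point method on the
   dual function. *)
apply: (@agd_error _ _ _ _ (fun=> 0) (dual f h G xst) (fun=> 0)
  (grad_dual gh Gy xst) ys _ _ _ _ _ _ th r rho Lpsi) => //.
- by move=> x u; rewrite /= !mul0r dot0l !addr0.
- move=> u y x; rewrite /= dot0l !add0r mulr_ge0 ?dot_ge0 //.
  by rewrite /= divr_ge0 // ltW.
- exact (dual_cvx S xstP).
- by rewrite add0r /grad_dual xstys.
- have : rho * muy <= 1 / 2 * muy by rewrite ler_pM2r.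
  by rewrite th0 /=; lra.
- exact: ltW.
- move=> yb; rewrite subr0.
  have [yst ystP] := exists_response S yb.
  have [xh xhP] := exists_prox_primal S ystP.
  (* Here min and max are exchanged: [xh] is also the best answer to [yst xh], so [yst xh] satisfies
     the optimality condition of the proximal step on the dual function. *)
  have xhE : xst (yst xh) = xh.
    apply/eqP; rewrite -subr_eq0; apply/eqP/norm2_eq0/eqP.
    have := monotone_norm (xst (yst xh)) xh (cvx_grad_monotone (best_x_cvx S (yst xh))).
    rewrite /= xstP xhP subrr norm20 => H.
    by rewrite eq_le norm2_ge0 andbT -(pmulr_rle0 _ mux0).
  set yh := yst xh in xhE; set d := norm2 (yb - ys).
  have d0 : 0 <= d by exact: norm2_ge0.
  have opt : LG *: (yb - yh) = grad_dual gh Gy xst yh.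
    by apply/eqP; rewrite eq_sym -subr_eq0 /grad_dual xhE -(ystP xh); apply/eqP; row_ring.
  (* By monotonicity of the dual gradient, an exact proximal step does not increase the distance to
     [ys]. *)
  have yhd : norm2 (yh - ys) <= d.
    have cm := cvx_grad_monotone (dual_cvx S xstP) yh ys.
    have : grad_dual gh Gy xst ys = 0 by rewrite /grad_dual xstys.
    move=> g0; rewrite g0 subr0 -opt in cm.
    have : 0 <= dot (yb - yh) (yh - ys).
      rewrite -(pmulr_rge0 _ h2) -dotZl; apply: le_trans cm.
      by rewrite mulr_ge0 ?dot_ge0 // ltW.
    rewrite (_ : yb - yh = (yb - ys) - (yh - ys)); last by row_ring.
    rewrite dotDl dotNl subr_ge0 -sqr_norm2 => /le_trans /(_ (dot_le_norm2 _ _)).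
    have [->|nz] := eqVneq (norm2 (yh - ys)) 0; first by [].
    by rewrite expr2 ler_pM2r // lt_def nz norm2_ge0.
  have xhd : norm2 (xh - xs) <= LG / mux * d.
    rewrite -xhE -xstys; apply: le_trans (best_x_lip S xstP _ _) _.
    by rewrite ler_wpM2l.
  rewrite eval_bind; set xt := eval o (prox_primalM _ _); set yt := eval o _.
  have xtB : norm2 (xt - xh) <= rhoB * (norm2 (x0 - xh) + norm2 (yb - yh)).
    exact: (prox_primal_error ystP x0 xhP).
  have ytB : norm2 (yt - yst xt) <= rhoD * norm2 (yb - yst xt).
    exact: response_error ystP xt.
  have lipy : norm2 (yst xt - yh) <= norm2 (xt - xh).
    by have := response_lip S ystP xt xh; rewrite mul1r.
  rewrite (_ : _ - _ = LG *: (yh - yt) +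
    (grad_dual gh Gy xst yh - grad_dual gh Gy xst yt)); last first.
    by rewrite -opt; row_ring.
  apply: le_trans (norm2D _ _) _; rewrite norm2Z gtr0_norm //.
  apply: le_trans (lerD (lexx _) (dual_lip S xstP _ _)) _; rewrite -mulrDl.
  (* The factor [2 + LG / mux] comes from [norm2 (yb - yh) <= 2 * d] and
     [norm2 (x0 - xh) <= r + LG / mux * d]; the factor 2 because an error in [xt] moves [yt] both
     through [yst] and through the response accuracy. *)
  rewrite [leRHS](_ : _ = (LG + Lpsi) *
    (2 * ((rhoB + rhoD) * ((2 + LG / mux) * (d + r))))); last by rewrite /th; ring.
  rewrite ler_wpM2l //; first exact: addr_ge0 (ltW LG0) Lpsi0.
  have N1 := norm2_tri ys yb yh; rewrite -/d (norm2B ys) in N1.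
  have N2 := norm2_tri xs x0 xh; rewrite -/r (norm2B xs) in N2.
  have N3 := norm2_tri yh yb (yst xt); rewrite (norm2B yh) in N3.
  have N4 := norm2_tri (yst xt) yt yh; rewrite norm2B.
  have A : norm2 (yt - yh) <= rhoD * norm2 (yb - yh) + 2 * norm2 (xt - xh).
    have : rhoD * norm2 (yb - yst xt) <= rhoD * norm2 (yb - yh) + norm2 (xt - xh).
      apply: (@le_trans _ _ (rhoD * (norm2 (yb - yh) + norm2 (xt - xh)))).
        by rewrite ler_pM2l //; lra.
      rewrite mulrDr lerD2l -[leRHS]mul1r ler_wpM2r ?norm2_ge0 //.
    by lra.
  have B : norm2 (x0 - xh) + norm2 (yb - yh) <= (2 + LG / mux) * (d + r).
    have := mulr_ge0 Lk0 r0; lra.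
  have C : norm2 (yb - yh) <= (2 + LG / mux) * (d + r).
    have := norm2_ge0 (x0 - xh); lra.
  set X := (2 + LG / mux) * (d + r) in B C *.
  have := ler_wpM2l (ltW rhoB0) B; have := ler_wpM2l (ltW rhoD0) C.
  have X0 : 0 <= X by rewrite mulr_ge0 // addr_ge0.
  have := mulr_ge0 (ltW rhoD0) X0.
  by lra.
- by move=> y y'; rewrite /= !add0r; apply: (dual_lip S xstP).
Qed.

End Errors.
End Algorithm.

(** * Gradients of convex functions *)

Section Gradient.
Context {R : realType}.

Lemma convex_strongly_convex n (f : 'rV[R]_n -> R) :
  convex_function setT f -> strongly_convex 0 f.
Proof.
move=> cf x y t /andP[t0 t1]; rewrite !mul0r subr0.
have := cf (Itv01 t0 t1) x y; rewrite !in_setT => /(_ isT isT).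
by rewrite convRE.
Qed.

(** Strong convexity along the segment from [x] to [u], divided by [t], in the limit of [t] to 0
    from the right; one directional derivative suffices. *)
Lemma strongly_convex_derive n (mu : R) (f : 'rV[R]_n -> R) x u :
  strongly_convex mu f -> derivable f x (u - x) ->
  f x + 'D_(u - x) f x + mu / 2 * dot (u - x) (u - x) <= f u.
Proof.
move=> cf df; set v := u - x.
have C1 := cvg_dnbhs_at_right df.
have C2 : (fun t => f u - f x - mu / 2 * (1 - t) * dot v v) @ (0 : R)^'+ -->
    f u - f x - mu / 2 * (1 - 0) * dot v v.
  apply: cvg_at_right_filter.
  apply: cvgB; first exact: cvg_cst.
  apply: cvgM; last exact: cvg_cst.
  apply: cvgM; first exact: cvg_cst.
  by apply: cvgB; [exact: cvg_cst|exact: cvg_id].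
suff : 'D_v f x <= f u - f x - mu / 2 * (1 - 0) * dot v v by lra.
apply: ler_cvg_to C1 C2 _; near=> t.
have t0 : 0 < t by near: t; exact: nbhs_right_gt.
have t1 : t <= 1 by near: t; exact: nbhs_right_le.
have := cf u x t; rewrite (ltW t0) t1 => /(_ isT).
rewrite sqr_norm2 -/v /= => H.
rewrite (_ : t *: u + (1 - t) *: x = t *: v + x) in H; last by rewrite /v; row_ring.
rewrite /GRing.scale /= -(ler_pM2l t0) mulrA mulfV ?gt_eqF // mul1r.
by lra.
Unshelve. all: by end_near. Qed.

Lemma derive_dot n (f : 'rV[R]_n -> R) x v : differentiable f x ->
  'D_v f x = dot (grad f x) v.
Proof.
move=> df; rewrite deriveE // {1}(row_sum_delta v) linear_sum /dot.
by apply: eq_bigr => i _; rewrite linearZ /= mxE deriveE // mulrC.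
Qed.

Lemma grad_cvx n (mu : R) (f : 'rV[R]_n -> R) :
  strongly_convex mu f -> (forall x, differentiable f x) ->
  cvx_grad mu f (grad f).
Proof.
move=> cf df x u; rewrite -derive_dot //.
exact/strongly_convex_derive/diff_derivable.
Qed.

Section Partial.
Variables (n m : nat) (g : 'rV[R]_n -> 'rV[R]_m -> R).

(** Partial difference quotients are those of [joint g] along [row_mx v 0]. Hence the partial
    gradients are the two halves of the joint gradient and inherit its Lipschitz constant. *)
Let quotient_l x y v :
  (fun h : R => h^-1 *: (((fun x' => g x' y) \o shift x) (h *: v) - g x y)) =
  (fun h : R => h^-1 *: ((joint g \o shift (row_mx x y)) (h *: row_mx v 0)
     - joint g (row_mx x y))).
Proof.
apply/funext => h; rewrite /joint /= scale_row_mx scaler0 add_row_mx add0r.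
by rewrite !row_mxKl !row_mxKr.
Qed.

Let quotient_r x y v :
  (fun h : R => h^-1 *: (((fun y' => g x y') \o shift y) (h *: v) - g x y)) =
  (fun h : R => h^-1 *: ((joint g \o shift (row_mx x y)) (h *: row_mx 0 v)
     - joint g (row_mx x y))).
Proof.
apply/funext => h; rewrite /joint /= scale_row_mx scaler0 add_row_mx add0r.
by rewrite !row_mxKl !row_mxKr.
Qed.

Hypothesis dg : forall z, differentiable (joint g) z.

Lemma derivable_l x y v : derivable (fun x' => g x' y) x v.
Proof. by rewrite /derivable quotient_l; exact: diff_derivable. Qed.

Lemma derivable_r x y v : derivable (fun y' => g x y') y v.
Proof. by rewrite /derivable quotient_r; exact: diff_derivable. Qed.

Lemma derive_l x y v :
  'D_v (fun x' => g x' y) x = dot (lsubmx (grad (joint g) (row_mx x y))) v.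
Proof.
rewrite /derive quotient_l -/(derive (joint g) (row_mx x y) (row_mx v 0)).
by rewrite derive_dot // -{1}[grad _ _]hsubmxK dot_row_mx dot0r addr0.
Qed.

Lemma derive_r x y v :
  'D_v (fun y' => g x y') y = dot (rsubmx (grad (joint g) (row_mx x y))) v.
Proof.
rewrite /derive quotient_r -/(derive (joint g) (row_mx x y) (row_mx 0 v)).
by rewrite derive_dot // -{1}[grad _ _]hsubmxK dot_row_mx dot0r add0r.
Qed.

Let dot_delta k (w : 'rV[R]_k) i : dot w (delta_mx 0 i) = w 0 i.
Proof.
rewrite /dot (bigD1 i) //= big1 => [|j ji]; first by rewrite mxE !eqxx mulr1 addr0.
by rewrite mxE (negPf ji) andbF mulr0.
Qed.

Lemma grad_l x y :
  grad (fun x' => g x' y) x = lsubmx (grad (joint g) (row_mx x y)).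
Proof. by apply/rowP => i; rewrite mxE derive_l dot_delta. Qed.

Lemma grad_r x y :
  grad (fun y' => g x y') y = rsubmx (grad (joint g) (row_mx x y)).
Proof. by apply/rowP => i; rewrite mxE derive_r dot_delta. Qed.

Lemma grad_l_cvx y : convex_function setT (fun x => g x y) ->
  cvx_grad 0 (fun x => g x y) (fun x => grad (fun x' => g x' y) x).
Proof.
move=> /convex_strongly_convex cg x u.
rewrite grad_l -derive_l; apply: strongly_convex_derive => //.
exact: derivable_l.
Qed.

Lemma grad_r_ccv x : convex_function setT (fun y => - g x y) ->
  cvx_grad 0 (fun y => - g x y) (fun y => - grad (fun y' => g x y') y).
Proof.
move=> /convex_strongly_convex cg y u.
rewrite grad_r dotNl -derive_r -deriveN; last exact: derivable_r.
apply: strongly_convex_derive => //.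
by apply: derivableN; exact: derivable_r.
Qed.

Variable L : R.
Hypothesis lg : lip L (grad (joint g)).

Lemma joint_lip z w : norm2 (lsubmx (grad (joint g) z) - lsubmx (grad (joint g) w))
    <= L * norm2 (z - w) /\
  norm2 (rsubmx (grad (joint g) z) - rsubmx (grad (joint g) w)) <= L * norm2 (z - w).
Proof.
split; rewrite -linearB.
  exact: le_trans (norm2_lsubmx _) (lg _ _).
exact: le_trans (norm2_rsubmx _) (lg _ _).
Qed.

Let distl (x x' : 'rV[R]_n) (y : 'rV[R]_m) :
  norm2 (row_mx x y - row_mx x' y) = norm2 (x - x').
Proof.
by rewrite opp_row_mx add_row_mx subrr /norm2 dot_row_mx dot0l addr0.
Qed.

Let distr (x : 'rV[R]_n) (y y' : 'rV[R]_m) :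
  norm2 (row_mx x y - row_mx x y') = norm2 (y - y').
Proof.
by rewrite opp_row_mx add_row_mx subrr /norm2 dot_row_mx dot0l add0r.
Qed.

Lemma grad_l_lipl y : lip L (fun x => grad (fun x' => g x' y) x).
Proof. by move=> x x'; rewrite !grad_l -(distl x x' y); exact: (joint_lip _ _).1. Qed.

Lemma grad_l_lipr x : lip L (fun y => grad (fun x' => g x' y) x).
Proof. by move=> y y'; rewrite !grad_l -(distr x y y'); exact: (joint_lip _ _).1. Qed.

Lemma grad_r_lipl y : lip L (fun x => grad (fun y' => g x y') y).
Proof. by move=> x x'; rewrite !grad_r -(distl x x' y); exact: (joint_lip _ _).2. Qed.

Lemma grad_r_lipr x : lip L (fun y => grad (fun y' => g x y') y).
Proof. by move=> y y'; rewrite !grad_r -(distr x y y'); exact: (joint_lip _ _).2. Qed.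

End Partial.

Lemma average_cvx n (m : nat) (F : 'I_m -> 'rV[R]_n -> R) g :
  (forall i, cvx_grad 0 (F i) (g i)) ->
  cvx_grad 0 (fun x => average (fun i => F i x))
    (fun x => m%:R^-1 *: \sum_(i < m) g i x).
Proof.
move=> cF x u; rewrite !mul0r addr0 /average dotZl -mulrDr.
rewrite ler_wpM2l ?invr_ge0 ?ler0n //.
have -> : dot (\sum_(i < m) g i x) (u - x) = \sum_(i < m) dot (g i x) (u - x).
  by elim/big_rec2 : _ => [|i a b _ <-]; rewrite ?dot0l ?dotDl.
rewrite -big_split ler_sum // => i _.
by have := cF i x u; rewrite !mul0r addr0.
Qed.

Lemma average_lip n k (m : nat) (L : 'I_m -> R) (g : 'I_m -> 'rV[R]_n -> 'rV[R]_k) :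
  (forall i, lip (L i) (g i)) ->
  lip (average L) (fun x => m%:R^-1 *: \sum_(i < m) g i x).
Proof.
move=> lg x y; rewrite -scalerBr norm2Z ger0_norm ?invr_ge0 ?ler0n // -mulrA.
rewrite ler_wpM2l ?invr_ge0 ?ler0n // -sumrB mulr_suml.
by apply: le_trans (norm2_sum _ _) _; apply: ler_sum => i _; exact: lg.
Qed.

(* The step [x - g x / (2 L)] would decrease [F] if [g x] were nonzero. *)
Lemma minimizer_grad0 n (L : R) (F : 'rV[R]_n -> R) g x :
  0 < L -> cvx_grad 0 F g -> lip L g -> (forall u, F x <= F u) -> g x = 0.
Proof.
move=> L0 cF lg xmin; pose t := (2 * L)^-1; pose u := x - t *: g x.
have t0 : 0 < t by rewrite invr_gt0 mulr_gt0.
have := cF u x; have := xmin u; have := lip_dot u x lg.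
have -> : x - u = t *: g x by rewrite /u; row_ring.
have -> : u - x = - (t *: g x) by rewrite /u; row_ring.
rewrite !mul0r addr0 !dotE => H1 H2 H3.
have Lt : L * t = 1 / 2 by rewrite /t; field; rewrite gt_eqF.
apply: dot_eq0; apply/eqP; rewrite eq_le dot_ge0 andbT.
have A : t * dot (g u) (g x) <= 0 by lra.
have {A} : dot (g u) (g x) <= 0 by move: A; rewrite pmulr_rle0.
have B : t * (dot (g x) (g x) - dot (g u) (g x)) <= t * (1 / 2 * dot (g x) (g x)).
  by rewrite -Lt; lra.
by move: B; rewrite ler_pM2l //; lra.
Qed.

End Gradient.

(** * From the oracle model to first-order inequalities *)

Section ProblemClass.
Context {R : realType} {dx dy m : nat}.
Variables (mux muy Lf Lh : R) (LGi : 'I_m -> R).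
Variables (f : 'rV[R]_dx -> R) (h : 'rV[R]_dy -> R).
Variable G : 'I_m -> 'rV[R]_dx -> 'rV[R]_dy -> R.
Variable o : oracle R dx dy m.
Hypothesis PC : problem_class mux muy Lf Lh LGi f h G.
Hypothesis oP : oracle_for f h G o.

Let LG := average LGi.
Let Gavg x y := average (fun i => G i x y).

(** The oracle promises a minimizer, while the analysis needs a stationarity equation; the prox
    objective is convex with a [c2 + Lh]-Lipschitz gradient, so one gives the other. *)
Lemma oracle_prox_opt c1 yb (c2 : {posnum R}) : 0 <= muy ->
  c1 + grad h (o (Prox c1 yb c2)) + c2%:num *: (o (Prox c1 yb c2) - yb) = 0.
Proof.
move=> muy0; have [Lh0 dh lh] := h_smooth PC.
have ch := cvx_gradW muy0 (grad_cvx (h_strongly_convex PC) dh).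
have c20 : 0 < c2%:num by [].
rewrite addrAC.
apply: (@minimizer_grad0 _ _ (c2%:num + Lh)
  (fun y => dot c1 y + c2%:num / 2 * dot (y - yb) (y - yb) + h y)
  (fun y => c1 + c2%:num *: (y - yb) + grad h y)).
- by rewrite ltr_pwDl.
- rewrite -[X in cvx_grad X]addr0; apply: cvx_gradD ch.
  by apply: cvx_gradW (cvx_grad_quad c1 yb c2%:num); exact: ltW.
- apply: lipD lh => x y.
  rewrite (_ : _ - _ = c2%:num *: (x - y)); last by row_ring.
  by rewrite norm2Z gtr0_norm.
- by move=> u; have := oracle_prox oP c1 yb c2 u; rewrite !sqr_norm2 /=; lra.
Qed.

Lemma saddle_of_problem_class : 0 < mux -> 0 < muy -> mux <= LG -> mux <= Lf ->
  muy <= LG ->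
  saddle_problem mux muy Lf Lh LG f (fun x => o (GradF x)) h (grad h) Gavg
    (fun x y => eval o (gradGxM x y)) (fun x y => eval o (gradGyM x y)).
Proof.
move=> mux0 muy0 muxG muxf muyG.
have -> : (fun x => o (GradF x)) = grad f by apply/funext => x; exact: oracle_f oP x.
have -> : (fun x y => eval o (gradGxM x y)) =
    fun x y => m%:R^-1 *: \sum_(i < m) grad (fun x' => G i x' y) x.
  apply/funext => x; apply/funext => y; rewrite eval_averageM; congr (_ *: _).
  by apply: eq_bigr => i _; exact: oracle_Gx oP i x y.
have -> : (fun x y => eval o (gradGyM x y)) =
    fun x y => m%:R^-1 *: \sum_(i < m) grad (fun y' => G i x y') y.
  apply/funext => x; apply/funext => y; rewrite eval_averageM; congr (_ *: _).
  by apply: eq_bigr => i _; exact: oracle_Gy oP i x y.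
have [Lf0 df lf] := f_smooth PC; have [Lh0 dh lh] := h_smooth PC.
have dG i z : differentiable (joint (G i)) z by have [_ + _] := G_smooth PC i; apply.
have lG i : lip (LGi i) (grad (joint (G i))) by have [_ _ +] := G_smooth PC i.
have avgN x : (fun y => - Gavg x y) = (fun y => average (fun i => - G i x y)).
  by apply/funext => y; rewrite /Gavg /average sumrN mulrN.
split => //.
- exact: (grad_cvx (f_strongly_convex PC) df).
- exact: (grad_cvx (h_strongly_convex PC) dh).
- move=> y; apply: (average_cvx (F := fun i x => G i x y)) => i.
  by apply: grad_l_cvx => //; exact: (G_convex PC i y).
- move=> x; rewrite avgN.
  have := @average_cvx R dy m (fun i y => - G i x y)
    (fun i y => - grad (fun y' => G i x y') y).
  rewrite (_ : (fun y => _ *: \sum_(i < m) - _) =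
    (fun y => - (m%:R^-1 *: \sum_(i < m) grad (fun y' => G i x y') y))).
    apply=> i; apply: grad_r_ccv => //; exact: (G_concave PC i x).
  by apply/funext => y; rewrite sumrN scalerN.
- by move=> y; apply: average_lip => i; exact: (grad_l_lipl (dG i) (lG i)).
- by move=> x; apply: average_lip => i; exact: (grad_l_lipr (dG i) (lG i)).
- by move=> y; apply: average_lip => i; exact: (grad_r_lipl (dG i) (lG i)).
- by move=> x; apply: average_lip => i; exact: (grad_r_lipr (dG i) (lG i)).
Qed.

End ProblemClass.

(** * Distance to the saddle point, optimality gap and residual *)

Section SaddleConsequences.
Context {R : realType} {dx dy : nat}.
Variables (mux muy Lf Lh LG : R).
Variables (f : 'rV[R]_dx -> R) (gf : 'rV[R]_dx -> 'rV[R]_dx).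
Variables (h : 'rV[R]_dy -> R) (gh : 'rV[R]_dy -> 'rV[R]_dy).
Variables (G : 'rV[R]_dx -> 'rV[R]_dy -> R).
Variables (Gx : 'rV[R]_dx -> 'rV[R]_dy -> 'rV[R]_dx).
Variables (Gy : 'rV[R]_dx -> 'rV[R]_dy -> 'rV[R]_dy).
Hypothesis S : saddle_problem mux muy Lf Lh LG f gf h gh G Gx Gy.
Variables (xs : 'rV[R]_dx) (ys : 'rV[R]_dy).
Hypotheses (xsP : gf xs + Gx xs ys = 0) (ysP : gh ys - Gy xs ys = 0).

Lemma stationary_saddle_point : saddle_point f h G xs ys.
Proof.
split=> [y|x].
  have := sp_h S ys y; have := sp_Gy S xs ys y.
  rewrite (_ : gh ys = Gy xs ys); last by apply/eqP; rewrite -subr_eq0 ysP.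
  have : 0 <= muy / 2 * dot (y - ys) (y - ys).
    by rewrite mulr_ge0 ?dot_ge0 // divr_ge0 // ltW // (sp_muy S).
  by rewrite dotNl !mul0r addr0; lra.
have := best_x_cvx S ys xs x; rewrite xsP dot0l addr0.
have : 0 <= mux / 2 * dot (x - xs) (x - xs).
  by rewrite mulr_ge0 ?dot_ge0 // divr_ge0 // ltW // (sp_mux S).
by lra.
Qed.

Lemma best_x_saddle xst : (forall y, gf (xst y) + Gx (xst y) y = 0) -> xst ys = xs.
Proof.
move=> xstP; apply/eqP; rewrite -subr_eq0; apply/eqP/norm2_eq0/eqP.
have := monotone_norm (xst ys) xs (cvx_grad_monotone (best_x_cvx S ys)).
rewrite /= xstP xsP subrr norm20 => H.
by rewrite eq_le norm2_ge0 andbT -(pmulr_rle0 _ (sp_mux S)).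
Qed.

(** The gap is [dual yhat - dual ys]. The dual gradient vanishes at [ys], so smoothness bounds the
    gap by the squared distance. *)
Lemma eps_solution_near (eps : R) yhat :
  lip_dual mux Lh LG * norm2 (yhat - ys) ^+ 2 <= eps ->
  eps_solution f h G eps yhat.
Proof.
have [xst xstP] := exists_best_x S.
have bx y x : f (xst y) + G (xst y) y <= f x + G x y := best_xP S xstP y x.
have c0 : cvx_grad 0 (dual f h G xst) (grad_dual gh Gy xst).
  by apply: cvx_gradW (dual_cvx S xstP); rewrite ltW // (sp_muy S).
have g0 : grad_dual gh Gy xst ys = 0 by rewrite /grad_dual (best_x_saddle xstP).
rewrite sqr_norm2 => H.
exists (- (f (xst yhat) + G (xst yhat) yhat)), (dual f h G xst ys), (dual f h G xst).
split.
- split=> [|x]; last first.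
    by have := bx yhat x; lra.
  by exists (xst yhat); rewrite opprD addrC.
- move=> y; split=> [|x]; last by have := bx y x; rewrite /dual; lra.
  by exists (xst y); rewrite /dual opprD addrAC addrA.
- split=> [|y]; first by exists ys.
  by have := c0 ys y; rewrite g0 dot0l !mul0r !addr0.
- by have := cvx_grad_gap yhat c0 (dual_lip S xstP) g0; rewrite /dual /=; lra.
Qed.

Section Distance.
Variables (x0 : 'rV[R]_dx) (y0 : 'rV[R]_dy).
Let r := norm2 (gf x0 + Gx x0 y0) + norm2 (gh y0 - Gy x0 y0).
Let dist := norm2 (row_mx x0 y0 - row_mx xs ys).

Let distE : row_mx x0 y0 - row_mx xs ys = row_mx (x0 - xs) (y0 - ys).
Proof. by rewrite opp_row_mx add_row_mx. Qed.

Lemma dist_x_le : norm2 (x0 - xs) <= dist.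
Proof. by rewrite /dist distE norm2_row_mxl. Qed.

Lemma dist_y_le : norm2 (y0 - ys) <= dist.
Proof. by rewrite /dist distE norm2_row_mxr. Qed.

(** The factor [mux^-1 + muy^-1] dominates the inverse of the smaller modulus; one [dist] then
    cancels between strong monotonicity and Cauchy-Schwarz. *)
Lemma dist_le_residual : dist <= (mux^-1 + muy^-1) * r.
Proof.
have [mux0 muy0] := (sp_mux S, sp_muy S).
have k0 : 0 < mux^-1 + muy^-1 by rewrite addr_gt0 // invr_gt0.
have := saddle_operator_monotone S x0 y0 xs ys; rewrite xsP ysP !subr0 => H.
have d0 : 0 <= dist by exact: norm2_ge0.
have [->|nz] := eqVneq dist 0; first by rewrite (mulr_ge0 (ltW k0)) ?addr_ge0 ?norm2_ge0.
have dp : 0 < dist by rewrite lt_def nz.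
have dE : dist ^+ 2 = dot (x0 - xs) (x0 - xs) + dot (y0 - ys) (y0 - ys).
  by rewrite sqr_norm2 distE dot_row_mx.
have U : dist ^+ 2 <= (mux^-1 + muy^-1) *
   (mux * dot (x0 - xs) (x0 - xs) + muy * dot (y0 - ys) (y0 - ys)).
  rewrite dE mulrDr; apply: lerD.
    rewrite mulrA -[leLHS]mul1r ler_wpM2r ?dot_ge0 // mulrDl mulVf ?gt_eqF //.
    by rewrite lerDl mulr_ge0 ?invr_ge0 // ltW.
  rewrite mulrA -[leLHS]mul1r ler_wpM2r ?dot_ge0 // mulrDl [muy^-1 * _]mulVf ?gt_eqF //.
  by rewrite lerDr mulr_ge0 ?invr_ge0 // ltW.
have V : dot (gf x0 + Gx x0 y0) (x0 - xs) + dot (gh y0 - Gy x0 y0) (y0 - ys) <= r * dist.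
  rewrite mulrDl; apply: lerD; apply: le_trans (dot_le_norm2 _ _) _.
    by rewrite ler_wpM2l ?norm2_ge0 // dist_x_le.
  by rewrite ler_wpM2l ?norm2_ge0 // dist_y_le.
rewrite -(ler_pM2r dp) -expr2 (le_trans U) // -mulrA ler_pM2l //.
exact: le_trans H V.
Qed.

(** The algorithm sees only the residual, but the complexity is stated with the true distance; this
    converse keeps the computed radius from exceeding it by more than a polynomial factor. *)
Lemma residual_le_dist : r <= (Lf + Lh + 4 * LG) * dist.
Proof.
have [dX dY] := (dist_x_le, dist_y_le).
have LG0 : 0 <= LG by apply: le_trans (sp_mux_LG S); rewrite ltW // (sp_mux S).
have Lf0 : 0 <= Lf by apply: le_trans (sp_mux_Lf S); rewrite ltW // (sp_mux S).
have A1 : norm2 (gf x0 + Gx x0 y0) <= (Lf + 2 * LG) * dist.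
  rewrite -[_ + _]subr0 -xsP.
  rewrite (_ : _ - _ = (gf x0 - gf xs) +
    ((Gx x0 y0 - Gx xs y0) + (Gx xs y0 - Gx xs ys))); last by row_ring.
  apply: le_trans (norm2D _ _) _; apply: le_trans (lerD (lexx _) (norm2D _ _)) _.
  have := sp_f_lip S x0 xs; have := sp_Gx_lipx S y0 x0 xs; have := sp_Gx_lipy S xs y0 ys.
  have := ler_wpM2l LG0 dX; have := ler_wpM2l LG0 dY; have := ler_wpM2l Lf0 dX.
  by lra.
have A2 : norm2 (gh y0 - Gy x0 y0) <= (Lh + 2 * LG) * dist.
  rewrite -[gh y0 - _]subr0 -ysP.
  rewrite (_ : _ - _ - _ = (gh y0 - gh ys) -
    ((Gy x0 y0 - Gy xs y0) + (Gy xs y0 - Gy xs ys))); last by row_ring.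
  apply: le_trans (norm2D _ _) _; rewrite norm2N.
  apply: le_trans (lerD (lexx _) (norm2D _ _)) _.
  have := sp_h_lip S y0 ys; have := sp_Gy_lipx S y0 x0 xs; have := sp_Gy_lipy S xs y0 ys.
  have := ler_wpM2l LG0 dX; have := ler_wpM2l LG0 dY; have := ler_wpM2l (sp_Lh S) dY.
  by lra.
by rewrite /r; lra.
Qed.

End Distance.
End SaddleConsequences.

(** * Choice of the accuracies *)

Section Accuracy.
Context {R : realType}.

(* Dominates every constant of the problem, the inverse of the target accuracy
   and the initial distance, so that all tolerances can be powers of its
   inverse. *)
Definition magnitude (eps S D : R) : R :=
  100 * ((1 + eps^-1) * (1 + S) * (1 + D)).

(* [30] leaves a margin of 2 over the square of the smallest tolerance, the 14th
   power of the inverse of the magnitude. *)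
Definition log_accuracy (eps S D : R) : R := 30 * ln (magnitude eps S D).

Section Bounds.
Variables eps S D : R.
Hypotheses (eps_gt0 : 0 < eps) (S_ge0 : 0 <= S) (D_ge0 : 0 <= D).

Let b := (magnitude eps S D)^-1.

Let e1 : 1 <= 1 + eps^-1.
Proof. by rewrite lerDl invr_ge0 ltW. Qed.
Let s1 : 1 <= 1 + S. Proof. by rewrite lerDl. Qed.
Let d1 : 1 <= 1 + D. Proof. by rewrite lerDl. Qed.

Let p1 : 1 <= (1 + eps^-1) * (1 + S) * (1 + D).
Proof. by rewrite !mulr_ege1. Qed.

Lemma magnitude_ge100 : 100 <= magnitude eps S D.
Proof. by have := p1; rewrite /magnitude; move: (_ * _) => p; lra. Qed.

Lemma magnitude_gt0 : 0 < magnitude eps S D.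
Proof. by have := magnitude_ge100; lra. Qed.

Let bound X : X <= (1 + eps^-1) * (1 + S) * (1 + D) -> 100 * X * b <= 1.
Proof.
move=> H; rewrite ler_pdivrMr ?magnitude_gt0 // mul1r /magnitude.
by move: (_ * (1 + D)) H => p; lra.
Qed.

Lemma magnitude_one : 100 * b <= 1.
Proof. by have := bound p1; rewrite mulr1. Qed.

Lemma magnitude_scale : 100 * S * b <= 1.
Proof.
apply: bound; apply: (@le_trans _ _ (1 + S)); first by rewrite lerDr.
by rewrite mulrAC ler_peMl ?mulr_ege1 // (le_trans _ s1).
Qed.

Lemma magnitude_dist : 100 * D * b <= 1.
Proof.
apply: bound; apply: (@le_trans _ _ (1 + D)); first by rewrite lerDr.
by rewrite ler_peMl ?mulr_ege1 // (le_trans _ d1).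
Qed.

Lemma magnitude_eps : 100 * b <= eps.
Proof.
have : 100 * eps^-1 * b <= 1.
  apply: bound; apply: (@le_trans _ _ (1 + eps^-1)); first by rewrite lerDr.
  by rewrite -mulrA ler_peMr ?mulr_ege1 // (le_trans _ e1).
by rewrite mulrAC ler_pdivrMr // mul1r.
Qed.

Lemma log_accuracy_ge1 : 1 <= log_accuracy eps S D.
Proof.
rewrite /log_accuracy; have B := magnitude_ge100.
have : 1 - ln (magnitude eps S D) <= b.
  have := expR_ge1Dx (- ln (magnitude eps S D)).
  by rewrite expRN lnK // posrE magnitude_gt0.
by have := magnitude_one; lra.
Qed.

Lemma expR_log_accuracy : expR (- log_accuracy eps S D) = b ^+ 30.
Proof.
by rewrite expRN expRM_natl lnK ?posrE ?magnitude_gt0 // exprVn.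
Qed.

End Bounds.
End Accuracy.

Section Tolerances.
Context {R : realType}.
Variable b : R.
Hypotheses (b_gt0 : 0 < b) (b_le : 100 * b <= 1).

Lemma pow_scale k j (X Y : R) : X * b ^+ j <= Y -> X * b ^+ (k + j) <= b ^+ k * Y.
Proof. by move=> H; rewrite exprD mulrCA ler_pM2l // exprn_gt0. Qed.

Lemma pow_le1 k : b ^+ k <= 1.
Proof. by rewrite exprn_ile1 ?ltW //; have := b_le; have := b_gt0; lra. Qed.

Lemma pow_absorb (X : R) j : 0 <= X -> X * b <= 1 -> X * b ^+ j.+2 <= b.
Proof.
move=> X0 Xb; rewrite 2!exprSr !mulrA -[leRHS]mul1r ler_pM2r // mulrAC.
have Xb0 := mulr_ge0 X0 (ltW b_gt0).
by apply: le_trans (ler_wpM2l Xb0 (pow_le1 j)) _; rewrite mulr1.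
Qed.

(** One factor [b] cancels the constant [X] up to 100, and another gives [100 * b <= Z <= Y]. A gap
    of two exponents therefore always suffices. *)
Lemma small_tolerance (X Y Z : R) k j :
  0 <= X -> X * b <= 100 -> 100 * b <= Z -> Z <= Y ->
  X * b ^+ (k + j.+2) <= b ^+ k * Y.
Proof.
move=> X0 Xb bZ ZY; apply: pow_scale; have := @pow_absorb (X / 100) j.
by rewrite divr_ge0 // => /(_ isT); lra.
Qed.

Section Dual.
Variables (mux Lh LG : R).
Hypotheses (mux_gt0 : 0 < mux) (Lh_ge0 : 0 <= Lh) (LG_gt0 : 0 < LG).
Hypotheses (Lh_b : 100 * (Lh * b) <= 1) (LG_b : 100 * (LG * b) <= 1).
Hypothesis mux_b : 100 * (mux^-1 * b) <= 1.
Let K := LG / mux.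
Let Lpsi := lip_dual mux Lh LG.

Lemma lip_dual_ge0 : 0 <= Lpsi.
Proof.
by rewrite /Lpsi /lip_dual !addr_ge0 // ?mulr_ge0 ?invr_ge0 // ltW.
Qed.

Lemma ratio_tolerance : K * b ^+ 2 <= 1 / 100 * (1 / 100).
Proof.
rewrite (_ : K * b ^+ 2 = (LG * b) * (mux^-1 * b)); last by rewrite /K; ring.
have [h1 h2] := (LG_b, mux_b).
by apply: ler_pM; rewrite ?mulr_ge0 ?invr_ge0 ?(ltW b_gt0) ?(ltW mux_gt0) ?(ltW LG_gt0) //; lra.
Qed.

(** The exponent 3 is dictated by the term [LG * LG * mux^-1]: one [b] for each factor. *)
Lemma dual_tolerance : Lpsi * b ^+ 3 <= 1 / 100 * (1 / 100).
Proof.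
have Kb := ratio_tolerance.
have Kp : 0 <= K * b ^+ 2 by rewrite !mulr_ge0 ?invr_ge0 // ltW.
have pLG : 0 <= LG * b by rewrite mulr_ge0 // ltW.
have pLh : 0 <= Lh * b by rewrite mulr_ge0 // ltW.
have p2 : 0 <= b ^+ 2 by rewrite exprn_ge0 // ltW.
have b2 : b ^+ 2 <= 1 / 100 * (1 / 100).
  by have h := b_le; rewrite expr2; apply: ler_pM; rewrite ?(ltW b_gt0) //; lra.
rewrite (_ : _ * _ = (Lh * b + LG * b) * b ^+ 2 + LG * b * (K * b ^+ 2)); last first.
  by rewrite /Lpsi /lip_dual -/K; ring.
have [h1 h2] := (LG_b, Lh_b).
have : (Lh * b + LG * b) * b ^+ 2 <= 2 / 100 * (1 / 100 * (1 / 100)).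
  by apply: ler_pM => //; lra.
have : LG * b * (K * b ^+ 2) <= 1 / 100 * (1 / 100 * (1 / 100)).
  by apply: ler_pM => //; lra.
by lra.
Qed.

Lemma outer_tolerance muy : 100 * b <= muy ->
  12 * (LG + Lpsi) * (b ^+ 10 + b ^+ 14) * (2 + K) <= b ^+ 3 * muy.
Proof.
move=> by'; have L0 := lip_dual_ge0.
have K0 : 0 <= K by rewrite divr_ge0 // ltW.
have LL : 0 <= LG + Lpsi by rewrite addr_ge0 // ltW.
have p2 : 0 <= b ^+ 2 by rewrite exprn_ge0 // ltW.
have b2 : b ^+ 2 <= 1 / 100 * (1 / 100).
  by have h := b_le; rewrite expr2; apply: ler_pM; rewrite ?(ltW b_gt0) //; lra.
apply: (@le_trans _ _ (24 * (LG + Lpsi) * (2 + K) * b ^+ 10)).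
  rewrite [leRHS](_ : _ = 12 * (LG + Lpsi) * (b ^+ 10 + b ^+ 10) * (2 + K)); last by ring.
  rewrite ler_wpM2r ?addr_ge0 // ler_wpM2l ?mulr_ge0 //.
  by rewrite lerD2l (exprD b 10 4) -[leRHS]mulr1 ler_pM2l ?pow_le1 // exprn_gt0.
apply: (@pow_scale 3 7).
(* The gap of 7 exponents from 3 to 10 is spent as 3 for [LG + Lpsi], 2 for [2 + K], and 2 to get
   below [muy]. *)
rewrite (_ : _ * _ = ((LG * b * b ^+ 2 + Lpsi * b ^+ 3) *
  (24 * (2 * b ^+ 2 + K * b ^+ 2))) * b ^+ 2); last by ring.
apply: (@le_trans _ _ b); last by have := b_gt0; lra.
have A0 : 0 <= LG * b * b ^+ 2 by rewrite !mulr_ge0 // ltW.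
have B0 : 0 <= Lpsi * b ^+ 3 by rewrite mulr_ge0 // exprn_ge0 // ltW.
have C0 : 0 <= K * b ^+ 2 by rewrite mulr_ge0.
have A : LG * b * b ^+ 2 <= 1 / 100 * (1 / 100).
  by have h := LG_b; apply: ler_pM => //; [rewrite mulr_ge0 // ltW|lra|lra].
have [B C] := (dual_tolerance, ratio_tolerance).
apply: (@pow_absorb _ 0).
  by rewrite mulr_ge0 ?addr_ge0 // mulr_ge0 // addr_ge0 // mulr_ge0.
apply: (@le_trans _ _ (1 * 1 * 1)); last by rewrite !mulr1.
have bb := b_le; have b0 := b_gt0.
apply: ler_pM; [|exact: ltW| |lra].
  by rewrite mulr_ge0 ?addr_ge0 // mulr_ge0 // addr_ge0 // mulr_ge0.
by apply: ler_pM; [lra|lra|lra|lra].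
Qed.

Lemma dual_log_tolerance muy : 100 * b <= muy ->
  b ^+ 30 * (2 * Lpsi + muy) <= (b ^+ 3) ^+ 2 * muy.
Proof.
move=> by'; rewrite -exprM mulrC; apply: (@pow_scale 6 24).
have L0 := lip_dual_ge0; have B := dual_tolerance.
have b0 := b_gt0; have bb := b_le.
have A1 : 2 * Lpsi * b ^+ 24 <= b.
  rewrite (_ : _ * _ = 2 * (Lpsi * b ^+ 3) * b ^+ 21); last first.
    by rewrite (exprD b 3 21); ring.
  have p3 : 0 <= Lpsi * b ^+ 3 by rewrite mulr_ge0 // exprn_ge0 // ltW.
  apply: pow_absorb; first by rewrite mulr_ge0.
  apply: (@le_trans _ _ (1 * 1)); last by rewrite mulr1.
  by apply: ler_pM; [rewrite mulr_ge0|exact: ltW|lra|lra].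
have A2 : 1 * b ^+ 24 <= b by apply: pow_absorb => //; lra.
have {}A2 : muy * b ^+ 24 <= muy * (1 / 2) by rewrite ler_pM2l; lra.
by rewrite mulrDl; lra.
Qed.

(** This fixes the final accuracy [b ^+ 3]: its square is [b ^+ 6], of which 3 powers pay for
    [Lpsi], 2 for the squared distance and 1 for [eps]. *)
Lemma accuracy_tolerance (D eps d : R) : 0 <= D -> 100 * (D * b) <= 1 ->
  100 * b <= eps -> 0 <= d -> d <= b ^+ 3 * (D + D) -> Lpsi * d ^+ 2 <= eps.
Proof.
move=> D0 bD beps d0 dB; have L0 := lip_dual_ge0; have B := dual_tolerance.
have Db0 : 0 <= D * b by rewrite mulr_ge0 // ltW.
have p3 : 0 <= Lpsi * b ^+ 3 by rewrite mulr_ge0 // exprn_ge0 // ltW.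
have d2 : d ^+ 2 <= (2 * (b ^+ 2 * (D * b))) ^+ 2.
  apply: lerXn2r; rewrite ?nnegrE //.
    by rewrite mulr_ge0 // mulr_ge0 // exprn_ge0 // ltW.
  by apply: le_trans dB _; rewrite le_eqVlt; apply/orP; left; apply/eqP; ring.
apply: le_trans (ler_wpM2l L0 d2) _; apply: le_trans beps.
rewrite (_ : Lpsi * _ = ((Lpsi * b ^+ 3) * (4 * (D * b) ^+ 2)) * b); last by ring.
rewrite ler_pM2r // -[leRHS]mul1r.
have Db2 : D * b * (D * b) <= 1 * 1 by apply: ler_pM => //; lra.
by apply: ler_pM; [exact: p3|rewrite mulr_ge0 // sqr_ge0|lra|rewrite expr2; lra].
Qed.

End Dual.
End Tolerances.

Section Correctness.
Context {R : realType} {dx dy m : nat}.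
Variables (mux muy Lf Lh LG eps D : R) (c : {posnum R}).
Variable o : oracle R dx dy m.
Variables (f : 'rV[R]_dx -> R) (h : 'rV[R]_dy -> R).
Variables (G : 'rV[R]_dx -> 'rV[R]_dy -> R) (gh : 'rV[R]_dy -> 'rV[R]_dy).
Let gf x : 'rV[R]_dx := o (GradF x).
Let Gx x y := eval o (gradGxM x y).
Let Gy x y := eval o (gradGyM x y).
Hypothesis S : saddle_problem mux muy Lf Lh LG f gf h gh G Gx Gy.
Hypothesis proxP : forall c1 yb (c2 : {posnum R}),
  c1 + gh (o (Prox c1 yb c2)) + c2%:num *: (o (Prox c1 yb c2) - yb) = 0.
Hypotheses (cE : c%:num = 3 * LG) (eps0 : 0 < eps) (D0 : 0 <= D).
Variables (x0 : 'rV[R]_dx) (y0 : 'rV[R]_dy) (xs : 'rV[R]_dx) (ys : 'rV[R]_dy).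
Hypotheses (xsP : gf xs + Gx xs ys = 0) (ysP : gh ys - Gy xs ys = 0).
Hypotheses (xD : norm2 (x0 - xs) <= D) (yD : norm2 (y0 - ys) <= D).

Let Sc := Lf + Lh + LG + mux^-1 + muy^-1.
Let Lam := log_accuracy eps Sc D.

Lemma saddleM_correct :
  eps_solution f h G eps (eval o (saddleM mux muy Lf LG Lam c x0 y0)).
Proof.
have [mux0 muy0] := (sp_mux S, sp_muy S); have [muxG muyG] := (sp_mux_LG S, sp_muy_LG S).
have [Lh0 muxf] := (sp_Lh S, sp_mux_Lf S); have [xD' yD'] := (xD, yD).
have LG0 : 0 < LG by lra.
have Lf0 : 0 < Lf by lra.
have ix0 : 0 < mux^-1 by rewrite invr_gt0.
have iy0 : 0 < muy^-1 by rewrite invr_gt0.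
have Sc0 : 0 <= Sc by rewrite /Sc; lra.
have E := expR_log_accuracy eps0 Sc0 D0.
have Lam1 := log_accuracy_ge1 eps0 Sc0 D0.
have b0 : 0 < (magnitude eps Sc D)^-1 by rewrite invr_gt0 magnitude_gt0.
have bone := magnitude_one eps0 Sc0 D0.
have bD := magnitude_dist eps0 Sc0 D0.
have beps := magnitude_eps eps0 Sc0 D0.
have bS := magnitude_scale eps0 Sc0 D0.
rewrite -/Lam in E Lam1.
move: (magnitude _ _ _)^-1 E b0 bone bD beps bS => b E b0 bone bD beps bS.
have bX X : X <= Sc -> 100 * (X * b) <= 1.
  by move=> XS; apply: le_trans bS; rewrite -mulrA ler_pM2l // ler_pM2r.
have [bLf bLh bLG bx_ by_] : [/\ 100 * (Lf * b) <= 1, 100 * (Lh * b) <= 1,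
    100 * (LG * b) <= 1, 100 * (mux^-1 * b) <= 1 & 100 * (muy^-1 * b) <= 1].
  by rewrite /Sc in bX; split; apply: bX; lra.
have bx : 100 * b <= mux.
  by move: bx_; rewrite mulrCA mulrC ler_pdivrMr // mul1r.
have by' : 100 * b <= muy.
  by move: by_; rewrite mulrCA mulrC ler_pdivrMr // mul1r.
have pos k : 0 < b ^+ k by rewrite exprn_gt0.
have le1 k : b ^+ k <= 1 by exact: pow_le1.
have half k : b ^+ k.+2 <= 1 / 2.
  have := @pow_absorb _ b b0 bone 1 k ler01.
  by rewrite !mul1r => /(_ _)/le_trans; apply; lra.
apply: (eps_solution_near S xsP ysP).
apply: (accuracy_tolerance b0 bone mux0 Lh0 LG0 bLh bLG bx_ D0 _ beps (norm2_ge0 _)).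
  by rewrite mulrA.
apply: (@le_trans _ _ (b ^+ 3 * (norm2 (y0 - ys) + norm2 (x0 - xs)))); last first.
  by rewrite ler_pM2l // lerD.
have small := small_tolerance b0 bone.

(* From 3 to 10 the gap is that of [outer_tolerance]; from 10 to 12 and from 12 to 14 it is the two
   exponents of [small_tolerance]. *)
apply: (@saddle_error _ _ _ _ mux muy Lf LG Lam c Lh o f h G gh S proxP cE
  (b ^+ 3) (b ^+ 14) (b ^+ 10) (b ^+ 12) (Lf + 4 * LG)) => //.
- lra.
- lra.
- lra.
- rewrite E -exprM mulrC; apply: (small _ _ mux 28 0); lra.
- by apply: (small _ _ mux 10 0); lra.
- by rewrite mulrA; apply: (small _ _ mux 10 2); lra.
- by rewrite mulrA; apply: (small _ _ mux 12 0); lra.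
- by rewrite E -exprM mulrC; apply: (small _ _ mux 24 4); lra.
- by rewrite E -exprM mulrC; apply: (small _ _ mux 20 8); lra.
- exact: outer_tolerance.
- by rewrite E; exact: dual_log_tolerance.
Qed.

End Correctness.

(** * Oracle complexity *)

Section Steps.
Context {R : realType}.

(** The inverse rate is the square root of [1 + L / mu]; [K] collects the numerical factor left over
    when this is compared with the target ratio [X]. *)
Lemma agd_steps_sqrt (Lam L mu K X : R) : 1 <= Lam -> 0 < L -> 0 < mu ->
  0 <= K -> 1 + L / mu <= K ^+ 2 * X ->
  (agd_steps Lam (agd_rate L mu))%:R <= 5 * Lam * (K * Num.sqrt X).
Proof.
move=> Lam1 L0 mu0 K0 H.
apply: le_trans (agd_steps_le Lam1 _) _; first by rewrite agd_rate_gt0 ?agd_rate_lt1.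
rewrite ler_wpM2l ?mulr_ge0 //; first by apply: le_trans Lam1.
rewrite -sqrtrV; last by rewrite divr_ge0 // ltW // addr_gt0.
rewrite invf_div -[K in leRHS](ger0_norm K0) -sqrtr_sqr -sqrtrM ?sqr_ge0 //.
by rewrite ler_wsqrtr // mulrDl [mu / mu]divff ?gt_eqF // addrC.
Qed.

(** The computed radius is polynomial in the constants and linear in the distance, so
    [1 + D <= 4 * (1 + S) ^+ 3]. The magnitude is then at most 400 times
    [(1 + eps^-1) * (1 + S) ^+ 4], whence [ln 400 + 4]. *)
Lemma log_accuracy_le (eps S S' D d : R) : 0 < eps -> 0 <= S' -> 0 <= d -> 0 <= D ->
  D <= 4 * S' ^+ 2 * d -> S = S' + d ->
  log_accuracy eps S' D <= 30 * (ln 400 + 4) * logfactor eps S.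
Proof.
move=> eps0 S'0 d0 D0 DS SE; rewrite /log_accuracy -mulrA ler_pM2l //.
have S0 : 0 <= S by rewrite SE addr_ge0.
have e1 : 1 <= 1 + eps^-1 by rewrite lerDl invr_ge0 ltW.
have s1 : 1 <= 1 + S by rewrite lerDl.
have pe : 0 < 1 + eps^-1 by apply: lt_le_trans e1.
have ps : 0 < 1 + S by apply: lt_le_trans s1.
have ps' : 0 < 1 + S' by rewrite ltr_pwDl.
have pd : 0 < 1 + D by rewrite ltr_pwDl.
have DB : 1 + D <= 4 * (1 + S) ^+ 3.
  have : S' ^+ 2 * d <= S ^+ 2 * S.
    apply: ler_pM => //; rewrite ?sqr_ge0 //; last by rewrite SE lerDr.
    by apply: lerXn2r; rewrite ?nnegrE // SE lerDl.
  have := mulr_ge0 S0 S0; lra.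
have [u uE] : exists u : R, u = 400 by exists 400.
have u0 : 0 < u by rewrite uE ltr0n.
have u1 : 1 <= u by rewrite uE ler1n.
have u4 : u = 100 * 4 by rewrite uE -natrM.
rewrite -uE; clear uE.
have M : magnitude eps S' D <= u * ((1 + eps^-1) * (1 + S) ^+ 4).
  rewrite [leRHS](_ : _ = 100 * ((1 + eps^-1) * (1 + S) * (4 * (1 + S) ^+ 3)));
    last by rewrite u4; ring.
  rewrite /magnitude ler_pM2l // -!mulrA ler_pM2l //.
  by apply: ler_pM => //; [exact: ltW|exact: ltW|rewrite SE lerD2l lerDl].
apply: (@le_trans _ _ (ln (u * ((1 + eps^-1) * (1 + S) ^+ 4)))).
  rewrite ler_ln ?posrE ?(magnitude_gt0 eps0 S'0 D0) //.
  by rewrite !mulr_gt0 // exprn_gt0.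
rewrite lnM ?posrE // ?mulr_gt0 ?exprn_gt0 //.
rewrite lnM ?posrE ?exprn_gt0 // lnXn // -mulr_natl /logfactor.
have l1 : 0 <= ln (1 + eps^-1) by rewrite ln_ge0.
have l2 : 0 <= ln (1 + S) by rewrite ln_ge0.
have l3 : 0 <= ln u by rewrite ln_ge0.
have := mulr_ge0 l3 l1; have := mulr_ge0 l3 l2.
move: (ln u) (ln (1 + eps^-1)) (ln (1 + S)) l1 l2 l3 => x v w; lra.
Qed.

End Steps.

Section Cost.
Context {R : realType} {dx dy m : nat}.
Variables (mux muy Lf LG Lam : R) (c : {posnum R}).
Variables (P : pred (query R dx dy m)) (o : oracle R dx dy m).
(** Symbolic unit costs for the three kinds of gradients that [saddleM] asks for: one bound serves
    all the counts by setting them to 0 or 1. *)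
Variables (cF cX cY : nat).
Hypotheses (mux0 : 0 < mux) (muy0 : 0 < muy) (muxf : mux <= Lf).
Hypotheses (muxG : mux <= LG) (muyG : muy <= LG) (Lam1 : 1 <= Lam).
Hypotheses (PF : forall x, nat_of_bool (P (GradF x)) = cF).
Hypotheses (PX : forall i x y, nat_of_bool (P (GradGx i x y)) = cX).
Hypotheses (PY : forall i x y, nat_of_bool (P (GradGy i x y)) = cY).
Hypotheses (Pprox : forall c1 yb c2, P (Prox c1 yb c2) = false).

Let Z := 10 * Lam.
Let LG0 : 0 < LG. Proof. exact: lt_le_trans muxG. Qed.
Let Lf0 : 0 < Lf. Proof. exact: lt_le_trans muxf. Qed.
Let Lam0 : 0 <= Lam. Proof. exact: le_trans Lam1. Qed.
Let Z0 : 0 <= Z. Proof. exact: mulr_ge0. Qed.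

Lemma cost_gradGxM x y : cost P o (gradGxM x y) = (m * cX)%N.
Proof. by apply: cost_averageM => i; rewrite /= PX addn0. Qed.

Lemma cost_gradGyM x y : cost P o (gradGyM x y) = (m * cY)%N.
Proof. by apply: cost_averageM => i; rewrite /= PY addn0. Qed.

Lemma cost_responseM x yb :
  (cost P o (responseM LG Lam c x yb))%:R <= Z * (m * cY)%:R.
Proof.
have := @cost_agdM R dx dy m dy (2 * LG) LG Lam _ yb P o (m * cY) _.
move=> /(_ (fun y => bind (gradGyM x y) (fun g =>
    ask (Prox (- g - LG *: yb - 2 * LG *: y) 0 c)))) H.
have {}H : (cost P o (responseM LG Lam c x yb) <=
  agd_steps Lam (agd_rate (2 * LG) LG) * (m * cY))%N.
  by apply: H => y; rewrite cost_bind cost_gradGyM /= Pprox !addn0.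
apply: (@le_trans _ _ (agd_steps Lam (agd_rate (2 * LG) LG) * (m * cY))%:R).
  by rewrite ler_nat.
rewrite natrM ler_wpM2r ?ler0n //.
apply: le_trans (@agd_steps_sqrt _ _ _ _ 2 1 Lam1 _ LG0 _ _) _ => //.
- by rewrite mulr_gt0.
- by rewrite mulfK ?gt_eqF //; lra.
- by rewrite sqrtr1 /Z; lra.
Qed.

Lemma cost_grad_primalM x yb :
  (cost P o (grad_primalM LG Lam c yb x))%:R <= (m * cX)%:R + Z * (m * cY)%:R.
Proof.
by rewrite cost_bind cost_gradGxM natrD addrC lerD2l cost_responseM.
Qed.

Lemma cost_prox_primalM x0 yb :
  (cost P o (prox_primalM mux Lf LG Lam c x0 yb))%:R <=
    3 / 2 * Z ^+ 2 * (Num.sqrt (Lf / mux) * cF%:R +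
      Num.sqrt (LG / mux) * ((m * cX)%:R + Z * (m * cY)%:R)).
Proof.
have W : 0 <= (m * cX)%:R + Z * (m * cY)%:R :> R by rewrite addr_ge0 ?mulr_ge0 ?ler0n.
(* Costs are natural numbers, so rounding the real bound down loses nothing and gives the natural
   bound that [cost_slidingM] takes. *)
pose N := Num.truncn ((m * cX)%:R + Z * (m * cY)%:R : R).
have NW : N%:R <= (m * cX)%:R + Z * (m * cY)%:R :> R.
  by have /andP[] := truncn_itv W.
have gN x : (cost P o (grad_primalM LG Lam c yb x) <= N)%N.
  have /andP[_ h] := truncn_itv W; rewrite -ltnS -(ltr_nat R).
  exact: le_lt_trans (cost_grad_primalM x yb) h.
have fN x : (cost P o (ask (GradF x)) <= cF)%N by rewrite /= PF addn0.
have sq0 (X : R) : 0 <= Num.sqrt X by exact: sqrtr_ge0.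
have [[[h1 h2] h3] h4] := (mux0, LG0, Lf0, muxf).
have [[k1 k2] k3] := (muxG, Lam1, Z0).
(* The two nested loop lengths multiply to the rate of the rougher term alone, so each gradient is
   paid at its own condition number. *)
have sw (X Y : R) : 0 < X -> 0 < Y ->
    Num.sqrt (X / mux) * Num.sqrt (Y / X) = Num.sqrt (Y / mux).
  move=> X0 Y0; rewrite -sqrtrM; last by rewrite divr_ge0 // ltW.
  by congr Num.sqrt; field; rewrite !gt_eqF.
(* The outer sliding loop contributes [3 / 2 * Z * a] and the inner one [Z * b]; both cases below
   differ only in [a] and [b]. *)
have cover a b (na nb : nat) : 0 <= b ->
    na%:R <= 5 * Lam * (3 * a) -> nb%:R <= 5 * Lam * (2 * b) -> 1 <= a -> forall p q : nat,
  (na * (p + nb * q))%:R <= 3 / 2 * Z ^+ 2 * (a * p%:R + a * b * q%:R) :> R.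
  move=> b0 Ha Hb a1 p q; rewrite natrM natrD natrM.
  apply: (@le_trans _ _ (3 / 2 * Z * a * (p%:R + Z * b * q%:R))).
    apply: ler_pM; rewrite ?ler0n ?addr_ge0 ?mulr_ge0 ?ler0n //.
      by apply: le_trans Ha _; rewrite /Z; lra.
    rewrite lerD2l ler_wpM2r ?ler0n //; apply: le_trans Hb _; rewrite /Z; lra.
  have p0 : 0 <= p%:R :> R by exact: ler0n.
  have Z1 : 1 <= Z by rewrite /Z; lra.
  have H : 0 <= 3 / 2 * Z * a * p%:R * (Z - 1).
    by rewrite !mulr_ge0 ?subr_ge0 //; lra.
  by lra.
have s1 X : mux <= X -> 1 <= Num.sqrt (X / mux).
  by move=> mX; rewrite -sqrtr1 ler_wsqrtr // ler_pdivlMr // mul1r.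
rewrite /prox_primalM; case: ifPn => LL.
  have := cost_slidingM mux (2 * LG) Lf Lam x0 gN fN.
  rewrite -(ler_nat R) => /le_trans; apply.
  apply: le_trans (cover (Num.sqrt (LG / mux)) (Num.sqrt (Lf / LG)) _ _ _ _ _ _ _ _) _ => //.
  - apply: agd_steps_sqrt => //; first lra.
    have : 1 <= LG / mux by rewrite ler_pdivlMr // mul1r.
    by lra.
  - apply: agd_steps_sqrt => //; [lra|lra|].
    have -> : 2 * Lf / (2 * (2 * LG)) = 1 / 2 * (Lf / LG).
      by field; rewrite gt_eqF.
    have : 2 <= Lf / LG by rewrite ler_pdivlMr.
    by lra.
  - exact: s1.
  rewrite sw // ler_wpM2l ?mulr_ge0 ?sqr_ge0 // addrC lerD2l.
  by rewrite ler_wpM2l.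
rewrite -ltNge in LL.
have fN' (x : 'rV[R]_dx) : (cost P o (bind (ask (GradF x))
    (fun g => Ret ((g : 'rV[R]_dx) - mux *: x)%R)) <= cF)%N.
  by rewrite cost_bind addn0.
have gN' (x : 'rV[R]_dx) : (cost P o (bind (grad_primalM LG Lam c yb x)
    (fun g => Ret (g + mux *: x)%R)) <= N)%N.
  by rewrite cost_bind addn0.
have := cost_slidingM mux (2 * Lf) (4 * LG) Lam x0 fN' gN'.
rewrite -(ler_nat R) => /le_trans; apply.
apply: le_trans (cover (Num.sqrt (Lf / mux)) (Num.sqrt (LG / Lf)) _ _ _ _ _ _ _ _) _ => //.
- apply: agd_steps_sqrt => //; first lra.
  have : 1 <= Lf / mux by rewrite ler_pdivlMr // mul1r.
  by lra.
- apply: agd_steps_sqrt => //; [lra|lra|].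
  have -> : 2 * (4 * LG) / (2 * (2 * Lf)) = 2 * (LG / Lf).
    by field; rewrite gt_eqF.
  have : 1 / 2 <= LG / Lf by rewrite ler_pdivlMr //; lra.
  by lra.
- exact: s1.
rewrite sw // ler_wpM2l ?mulr_ge0 ?sqr_ge0 // lerD2l.
by rewrite ler_wpM2l.
Qed.

Lemma cost_saddleM x0 y0 :
  (cost P o (saddleM mux muy Lf LG Lam c x0 y0))%:R <=
    Z * Num.sqrt (LG / muy) *
      (3 / 2 * Z ^+ 2 * (Num.sqrt (Lf / mux) * cF%:R +
        Num.sqrt (LG / mux) * ((m * cX)%:R + Z * (m * cY)%:R)) + Z * (m * cY)%:R).
Proof.
set W := (X in _ <= _ * X).
have sq0 (X : R) : 0 <= Num.sqrt X by exact: sqrtr_ge0.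
have W0 : 0 <= W.
  have X0 : 0 <= (m * cX)%:R + Z * (m * cY)%:R :> R.
    by rewrite addr_ge0 ?mulr_ge0 ?ler0n.
  apply: addr_ge0; last by rewrite mulr_ge0 ?ler0n.
  apply: mulr_ge0; first by rewrite mulr_ge0 ?sqr_ge0.
  by apply: addr_ge0; rewrite mulr_ge0 ?ler0n.
pose N := Num.truncn W.
have NW : N%:R <= W by have /andP[] := truncn_itv W0.
have pN yb : (cost P o (prox_dualM mux Lf LG Lam c x0 yb) <= N)%N.
  have /andP[_ h] := truncn_itv W0; rewrite -ltnS -(ltr_nat R).
  apply: le_lt_trans h; rewrite cost_bind natrD.
  by rewrite lerD ?cost_prox_primalM ?cost_responseM.
have := cost_agdM LG muy Lam y0 pN; rewrite -(ler_nat R) => /le_trans; apply.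
rewrite natrM; apply: ler_pM; rewrite ?ler0n //.
apply: le_trans (@agd_steps_sqrt _ _ _ _ 2 (LG / muy) Lam1 LG0 muy0 _ _) _ => //.
  have : 1 <= LG / muy by rewrite ler_pdivlMr // mul1r.
  by lra.
by rewrite /Z; have := sq0 (LG / muy); lra.
Qed.

End Cost.

Theorem theorem8 (R : realType) :
  exists (C : R) (p : nat),
  forall (dx dy m : nat) (mux muy Lf Lh : R) (LGi : 'I_m -> R),
  let LG := average LGi in
  (0 < m)%N -> 0 < mux -> 0 < muy ->
  mux <= LG -> mux <= Lf -> muy <= LG ->
  forall (eps : R), 0 < eps ->
  forall (x0 : 'rV[R]_dx) (y0 : 'rV[R]_dy),
  exists A : algorithm R dx dy m,
  forall (f : 'rV[R]_dx -> R) (h : 'rV[R]_dy -> R)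
         (G : 'I_m -> 'rV[R]_dx -> 'rV[R]_dy -> R),
  problem_class mux muy Lf Lh LGi f h G ->
  let Gavg := fun x y => average (fun i => G i x y) in
  forall o : oracle R dx dy m, oracle_for f h G o ->
    eps_solution f h Gavg eps (output o A) /\
    exists (xs : 'rV[R]_dx) (ys : 'rV[R]_dy),
      saddle_point f h Gavg xs ys /\
      let dist := norm2 (row_mx x0 y0 - row_mx xs ys) in
      let polylog :=
        logfactor eps (Lf + Lh + LG + mux^-1 + muy^-1 + dist) ^+ p in
      [/\ (calls (@is_gradF R dx dy m) o A)%:R
            <= C * Num.sqrt ((LG * Lf) / (mux * muy)) * polylog,
          (calls (@is_gradH R dx dy m) o A)%:R
            <= C * Num.sqrt (LG / muy) * polylog,
          (calls (@is_gradGx R dx dy m) o A)%:R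
            <= C * (m%:R * Num.sqrt (LG ^+ 2 / (mux * muy))) * polylog &
          (calls (@is_gradGy R dx dy m) o A)%:R
            <= C * (m%:R * Num.sqrt (LG ^+ 2 / (mux * muy))) * polylog].
Proof.
pose K : R := 30 * (ln 400 + 4).
(* The power 4 counts the nested loops: outer, two of sliding, and response, each contributing
   [10 * Lam]. The leading 4 covers [1 + 3 / 2 + 1], for the initial query, the sliding loops and
   the final response of each outer step. *)
exists (4 * (10 * K) ^+ 4), 4%N => dx dy m mux muy Lf Lh LGi LG.
move=> m0 mux0 muy0 muxG muxf muyG.
move=> eps eps0 x0 y0.
have LG0 : 0 < LG by exact: lt_le_trans muxG.
have c0 : 0 < 3 * LG by rewrite mulr_gt0.
pose Sc := Lf + Lh + LG + mux^-1 + muy^-1.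
pose radius (a : 'rV[R]_dx) (b : 'rV[R]_dy) : R :=
  (mux^-1 + muy^-1) * (norm2 a + norm2 b).
(* Built from the constants, [eps] and the starting point alone; the radius that determines [Lam] is
   computed from the first answers. *)
pose A : @prog R dx dy m 'rV[R]_dy :=
  bind (ask (GradF x0)) (fun gf => bind (ask (GradH y0)) (fun gh =>
  bind (gradGxM x0 y0) (fun gx => bind (gradGyM x0 y0) (fun gy =>
    saddleM mux muy Lf LG (log_accuracy eps Sc (radius (gf + gx) (gh - gy)))
      (PosNum c0) x0 y0)))).
exists (to_algorithm A) => f h G PC Gavg o oP.
have S := saddle_of_problem_class PC oP mux0 muy0 muxG muxf muyG.
have [xs [ys [xsP ysP]]] := exists_saddle S.
pose D := radius (o (GradF x0) + eval o (gradGxM x0 y0))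
  (o (GradH y0) - eval o (gradGyM x0 y0)).
have ohE : o (GradH y0) = grad h y0 := oracle_h oP y0.
set Lam := log_accuracy eps Sc D.
have evA : eval o A = eval o (saddleM mux muy Lf LG Lam (PosNum c0) x0 y0).
  by rewrite /A !eval_bind.
have Lh0 : 0 <= Lh := sp_Lh S.
have Lf0 : 0 < Lf by exact: lt_le_trans muxf.
have ix0 : 0 < mux^-1 by rewrite invr_gt0.
have iy0 : 0 < muy^-1 by rewrite invr_gt0.
have Sc0 : 0 <= Sc by rewrite /Sc; lra.
have D0 : 0 <= D by rewrite mulr_ge0 ?addr_ge0 ?norm2_ge0 // ltW.
have distD := dist_le_residual S xsP ysP x0 y0; rewrite -ohE -/(radius _ _) -/D in distD.
have resD := residual_le_dist S xsP ysP x0 y0; rewrite -ohE in resD.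
set d := norm2 _ in distD resD.
have d0 : 0 <= d by exact: norm2_ge0.
split.
  rewrite output_to_algorithm evA.
  apply: (saddleM_correct S (D := D) _ _ eps0 D0 xsP ysP) => //.
  - by move=> c1 yb c2; exact: (oracle_prox_opt PC oP c1 yb c2 (ltW muy0)).
  - exact: le_trans (dist_x_le _ _ _ _) distD.
  - exact: le_trans (dist_y_le _ _ _ _) distD.
exists xs, ys; split; first exact (stationary_saddle_point S xsP ysP).
cbv zeta; rewrite -/d; set l := logfactor _ _.
(* One [Sc] bounds [mux^-1 + muy^-1], and [4 * Sc] bounds the Lipschitz constant [Lf + Lh + 4 * LG]
   of the residual. *)
have DS : D <= 4 * Sc ^+ 2 * d.
  apply: (@le_trans _ _ (Sc * (4 * Sc * d))); last first.
    by rewrite le_eqVlt; apply/orP; left; apply/eqP; ring.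
  rewrite /D /radius; apply: ler_pM; rewrite ?addr_ge0 ?norm2_ge0 //;
    [lra|lra|by rewrite /Sc; lra|].
  apply: le_trans resD _; rewrite ler_wpM2r // -/LG /Sc; lra.
have LamK : Lam <= K * l by apply: log_accuracy_le DS _.
have Lam1 : 1 <= Lam := log_accuracy_ge1 eps0 Sc0 D0.
have costA P cF cH cX cY :
    (forall x, nat_of_bool (P (GradF x)) = cF) ->
    (forall y, nat_of_bool (P (GradH y)) = cH) ->
    (forall i x y, nat_of_bool (P (GradGx i x y)) = cX) ->
    (forall i x y, nat_of_bool (P (GradGy i x y)) = cY) ->
    (forall c1 yb c2, P (Prox c1 yb c2) = false) ->
  (calls P o (to_algorithm A))%:R <= cF%:R + cH%:R + (m * cX)%:R + (m * cY)%:R +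
    10 * Lam * Num.sqrt (LG / muy) *
      (3 / 2 * (10 * Lam) ^+ 2 * (Num.sqrt (Lf / mux) * cF%:R +
        Num.sqrt (LG / mux) * ((m * cX)%:R + 10 * Lam * (m * cY)%:R)) +
        10 * Lam * (m * cY)%:R).
  move=> PF PH PX PY Pprox; rewrite calls_to_algorithm /A 3!cost_bind (cost_gradGxM _ PX).
  rewrite cost_bind (cost_gradGyM _ PY) /= PF PH !addn0 !natrD !addrA lerD2l.
  exact: cost_saddleM.
have sA1 : 1 <= Num.sqrt (LG / muy).
  by rewrite -sqrtr1 ler_wsqrtr // ler_pdivlMr // mul1r.
have sF1 : 1 <= Num.sqrt (Lf / mux).
  by rewrite -sqrtr1 ler_wsqrtr // ler_pdivlMr // mul1r.
have sG1 : 1 <= Num.sqrt (LG / mux).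
  by rewrite -sqrtr1 ler_wsqrtr // ler_pdivlMr // mul1r.
have sFE : Num.sqrt (LG * Lf / (mux * muy)) = Num.sqrt (LG / muy) * Num.sqrt (Lf / mux).
  rewrite -sqrtrM; last by rewrite divr_ge0 // ltW.
  by congr Num.sqrt; field; rewrite !gt_eqF.
have sGE : Num.sqrt (LG ^+ 2 / (mux * muy)) = Num.sqrt (LG / muy) * Num.sqrt (LG / mux).
  rewrite -sqrtrM; last by rewrite divr_ge0 // ltW.
  by congr Num.sqrt; field; rewrite !gt_eqF.
pose Z := 10 * Lam; have Z1 : 1 <= Z by rewrite /Z; lra.
have CZ X : 0 <= X -> 4 * Z ^+ 4 * X <= 4 * (10 * K) ^+ 4 * X * l ^+ 4.
  move=> X0; rewrite [leRHS](_ : _ = 4 * (10 * (K * l)) ^+ 4 * X); last by ring.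
  rewrite ler_wpM2r // ler_pM2l //.
  by apply: lerXn2r; rewrite ?nnegrE /Z; move: (K * l) LamK => w; lra.
rewrite sFE sGE; move: sA1 sF1 sG1 => {sFE sGE}.
set sA := Num.sqrt (LG / muy); set sF := Num.sqrt (Lf / mux); set sG := Num.sqrt (LG / mux).
move=> sA1 sF1 sG1.
have pow_le (X Y : R) : 1 <= X -> 1 <= Y -> X <= X * Y /\ Y <= X * Y.
  by move=> X1 Y1; split; [rewrite ler_peMr //; lra|rewrite ler_peMl //; lra].
split.
- apply: le_trans (costA _ 1%N 0%N 0%N 0%N _ _ _ _ _) _ => //.
  apply: le_trans (CZ (sA * sF) _); last by rewrite mulr_ge0 //; lra.
  rewrite muln0 !mulr0 !addr0 mulr1 -/Z -/sA -/sF.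
  have T1 : 1 <= sA * sF by rewrite mulr_ege1.
  have Z3 : 1 <= Z ^+ 3 by rewrite exprn_ege1.
  have [_ Z4] := pow_le _ _ Z1 Z3; have [U _] := pow_le _ _ T1 Z3.
  have := ler_wpM2r (_ : 0 <= sA * sF) Z4; rewrite -exprS; lra.
(* The only gradient of [h] asked for is the one at [y0], since the loops reach [h] through its
   prox; the bound holds because [sA] and [Z] are at least 1. *)
- apply: le_trans (costA _ 0%N 1%N 0%N 0%N _ _ _ _ _) _ => //.
  apply: le_trans (CZ sA _); last by lra.
  rewrite muln0 !mulr0 !addr0 !mulr0 add0r addr0.
  have Z4 : 1 <= Z ^+ 4 by rewrite exprn_ege1.
  have [_ U] := pow_le _ _ Z4 sA1; lra.
- apply: le_trans (costA _ 0%N 0%N 1%N 0%N _ _ _ _ _) _ => //.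
  apply: le_trans (CZ (m%:R * (sA * sG)) _); last by rewrite !mulr_ge0 ?ler0n //; lra.
  rewrite muln0 muln1 !mulr0 !addr0 !add0r -/Z -/sA -/sG.
  have T1 : 1 <= sA * sG by rewrite mulr_ege1.
  have Z3 : 1 <= Z ^+ 3 by rewrite exprn_ege1.
  have Z4 : 1 <= Z ^+ 4 by rewrite exprn_ege1.
  have [_ U] := pow_le _ _ Z1 Z3; rewrite -exprS in U.
  have [_ V] := pow_le _ _ Z4 T1.
  have {}U : Z ^+ 3 * (sA * sG) <= Z ^+ 4 * (sA * sG) by rewrite ler_wpM2r //; lra.
  have M0 : 0 <= m%:R :> R by exact: ler0n.
  rewrite [leLHS](_ : _ = m%:R * (1 + 3 / 2 * (Z ^+ 3 * (sA * sG)))); last by ring.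
  rewrite [leRHS](_ : _ = m%:R * (4 * (Z ^+ 4 * (sA * sG)))); last by ring.
  by rewrite ler_wpM2l //; lra.
- apply: le_trans (costA _ 0%N 0%N 0%N 1%N _ _ _ _ _) _ => //.
  apply: le_trans (CZ (m%:R * (sA * sG)) _); last by rewrite !mulr_ge0 ?ler0n //; lra.
  rewrite muln0 muln1 !mulr0 !addr0 !add0r -/Z -/sA -/sG.
  have T1 : 1 <= sA * sG by rewrite mulr_ege1.
  have Z2 : 1 <= Z ^+ 2 by rewrite exprn_ege1.
  have Z4 : 1 <= Z ^+ 4 by rewrite exprn_ege1.
  have [_ V] := pow_le _ _ Z4 T1.
  have [_ U] := pow_le _ _ Z2 Z2; rewrite -exprD in U.
  have {}U : Z ^+ 2 * sA <= Z ^+ 4 * (sA * sG).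
    by apply: ler_pM => //; [lra|lra|exact: (pow_le _ _ sA1 sG1).1].
  have M0 : 0 <= m%:R :> R by exact: ler0n.
  rewrite [leLHS](_ : _ = m%:R *
    (1 + (3 / 2 * (Z ^+ 4 * (sA * sG)) + Z ^+ 2 * sA))); last by ring.
  rewrite [leRHS](_ : _ = m%:R * (4 * (Z ^+ 4 * (sA * sG)))); last by ring.
  by rewrite ler_wpM2l //; lra.
Qed.
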